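(* Let $J\in C^2(\mathbb R)$ satisfy $J''<0$ and $J(0)=J(1)=0$, and let $m\in(0,1)$ be the unique maximum point of $J$. Let $\rho_-,\rho_+\in C^1(\mathbb R_+)$ take values in $[0,1]$. Let $u\in L^\infty([0,\infty)\times[0,1])$ be an entropy solution of the quasi-static conservation law $$\partial_xJ(u)=0,\qquad u(t,0)=\rho_-(t),\quad u(t,1)=\rho_+(t).$$ Then there exist $z_1(t)\in[0,m]$ and $z_2(t)\in[m,1]$ such that $J(z_1(t))=J(z_2(t))$ and $$u(t,x)\in\{z_1(t),z_2(t)\}\quad\text{for almost every }(t,x).$$ Furthermore, for almost every $t$, either $u(t,\cdot)$ is almost everywhere constant on $(0,1)$, or $u(t,\cdot)$ has at most one upward jump, from $z_1(t)$ to $z_2(t)$, inside $(0,1)$ (that is, there is $X(t)\in(0,1)$ such that $u(t,x)=z_1(t)$ for a.e. $x<X(t)$ and $u(t,x)=z_2(t)$ for a.e. $x>X(t)$). In particular, $u(t,\cdot)$ is (a.e. equal to a function) of bounded variation for a.e. $t$.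
   Context: Notation: $\mathbb R_+=[0,\infty)$; $C_0$ and $C_0^\infty$ denote continuous, respectively smooth, compactly supported functions. A Lax entropy--entropy flux pair is a pair $(S,Q)$ with $S,Q\in C^2(\mathbb R)$, $S''\ge0$, $Q'=J'S'$. A boundary entropy--entropy flux pair is a pair $S,Q\in C^2(\mathbb R^2)$ such that for each $w\in\mathbb R$, $(S(\cdot,w),Q(\cdot,w))$ is a Lax entropy--entropy flux pair, and $S(w,w)=Q(w,w)=\partial_vS(v,w)|_{v=w}=0$; then $Q$ is called a boundary entropy flux. Entropy solution of the quasi-static law: a function $u\in L^\infty([0,\infty)\times[0,1])$ such that: (i) $\int_0^\infty\int_0^1J(u)\partial_x\varphi\,dx\,dt=0$ for all $\varphi\in C_0^\infty((0,\infty)\times(0,1))$; (ii) for every Lax pair $(S,Q)$ and every $\varphi\in C_0^\infty((0,\infty)\times(0,1))$ with $\varphi\ge0$, $\int_0^\infty\int_0^1Q(u)\partial_x\varphi\,dx\,dt\ge0$; (iii) for every boundary entropy flux $Q$ and every $\beta\in C_0(\mathbb R)$ with $\beta\ge0$, $\operatorname{ess\,lim}_{r\to0+}\int_0^\infty Q(u(t,r),\rho_-(t))\beta(t)\,dt\le0$ and $\operatorname{ess\,lim}_{r\to0+}\int_0^\infty Q(u(t,1-r),\rho_+(t))\beta(t)\,dt\ge0$. *)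

(* Defs.v *)
From HB Require Import structures.
From mathcomp Require Import all_boot all_order all_algebra.
From mathcomp Require Import all_classical all_reals all_analysis.

Set Implicit Arguments.
Unset Strict Implicit.
Unset Printing Implicit Defensive.

Import Order.TTheory GRing.Theory Num.Theory.
Import numFieldNormedType.Exports.

Local Open Scope classical_set_scope.
Local Open Scope ring_scope.

Notation leb R := (@lebesgue_measure R).
Notation leb2 R := (@lebesgue_measure R \x @lebesgue_measure R)%E.

(* In finite dimension, C^k is the iterated existence and continuity of all
   directional derivatives; it is used with V = R and V = R * R. *)
Fixpoint Ck (R : realType) (V : normedModType R) (k : nat) (f : V -> R) : Prop :=
  continuous f /\
  match k with
  | 0%N => True
  | k'.+1 => forall v : V, (forall x, derivable f x v) /\ Ck k' ('D_v f)
  end.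

Definition Cinfty (R : realType) (V : normedModType R) (f : V -> R) : Prop :=
  forall k, Ck k f.

(* C^1 on the closed half-line [0, +oo[, with a one-sided derivative at 0;
   the values of f on negative reals are irrelevant. *)
Definition C1_Rplus (R : realType) (f : R -> R) : Prop :=
  exists2 df : R -> R,
    {within `[0, +oo[, continuous df} &
    forall t, 0 <= t ->
      (f s - f t) / (s - t)
        @[s --> within [set s | 0 <= s /\ s != t] (nbhs t)] --> df t.

Definition tsupport (R : realType) (T : topologicalType) (f : T -> R) : set T :=
  closure [set x | f x != 0].

(* Points of R * R are (t, x). *)
Definition space_time (R : realType) : set (R * R) := `[0, +oo[ `*` `[0, 1].

Definition test_function (R : realType) (phi : R * R -> R) : Prop :=
  [/\ Cinfty phi, compact (tsupport phi)
    & tsupport phi `<=` `]0, +oo[ `*` `]0, 1[].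

Definition Linfty_space_time (R : realType) (u : R * R -> R) : Prop :=
  (u \_ (@space_time R)) \in Lfun (leb2 R) +oo%E.

Definition lax_pair (R : realType) (J S Q : R -> R) : Prop :=
  [/\ Ck 2 S, Ck 2 Q, (forall v, 0 <= S^`(2)%classic v)
    & forall v, Q^`()%classic v = J^`()%classic v * S^`()%classic v].

Definition boundary_pair (R : realType) (J : R -> R) (S Q : R * R -> R) : Prop :=
  [/\ Ck 2 S, Ck 2 Q,
      (forall w, lax_pair J (fun v => S (v, w)) (fun v => Q (v, w)))
    & forall w, [/\ S (w, w) = 0, Q (w, w) = 0
                  & (fun v => S (v, w))^`()%classic w = 0]].

Definition boundary_flux (R : realType) (J : R -> R) (Q : R * R -> R) : Prop :=
  exists S, boundary_pair J S Q.

(* ess lim_(r -> 0+) F(r) = l *)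
Definition ess_lim0 (R : realType) (F : R -> R) (l : R) : Prop :=
  exists2 N : set R, (leb R).-negligible N &
    F r @[r --> within (~` N) 0^'+] --> l.

(* The essential limits in the boundary conditions are required to exist. *)
Definition entropy_solution (R : realType) (J rhom rhop : R -> R)
    (u : R * R -> R) : Prop :=
  [/\ Linfty_space_time u,
      (forall phi, test_function phi ->
        \int[leb R]_(t in `[0, +oo[) \int[leb R]_(x in `[0, 1])
          (J (u (t, x)) * (fun y => phi (t, y))^`()%classic x) = 0),
      (forall S Q phi, lax_pair J S Q -> test_function phi ->
        (forall p, 0 <= phi p) ->
        0 <= \int[leb R]_(t in `[0, +oo[) \int[leb R]_(x in `[0, 1])
          (Q (u (t, x)) * (fun y => phi (t, y))^`()%classic x))
    & (forall Q (beta : R -> R), boundary_flux J Q ->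
        continuous beta -> compact (tsupport beta) -> (forall t, 0 <= beta t) ->
        (exists2 l, l <= 0 &
          ess_lim0 (fun r => \int[leb R]_(t in `[0, +oo[)
            (Q (u (t, r), rhom t) * beta t)) l) /\
        (exists2 l, 0 <= l &
          ess_lim0 (fun r => \int[leb R]_(t in `[0, +oo[)
            (Q (u (t, 1 - r), rhop t) * beta t)) l))].

(* Main.v *)
(* Testing the entropy inequality with products of bumps in t and trapezoids in x, the
   entropies [v], [-v] and [v^2] show that for almost every t the averages of J(u(t, .))
   do not depend on the interval and those of Q0(u(t, .)), Q0 the flux of [v^2], are
   nonincreasing; by Lebesgue differentiation J(u(t, .)) is a.e. a constant j(t) and
   Q0(u(t, .)) is a.e. nonincreasing.  Strict concavity of J leaves two possible values
   z1 <= z2 for u(t, .), and Q0(z2) < Q0(z1) when z1 < z2, so u can only jump from z1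
   up to z2.

   The quadratic boundary flux Q(v, w) = 2 J(v) (v - w) - 2 (K(v) - K(w)), with K' = J,
   is an affine function of J(v) and Q0(v) for fixed w, hence Q(u(t, x), rho-(t)) is
   nonincreasing in x as well.  Its boundary limit at x = 0 being nonpositive, it is
   nonpositive on the whole strip, which excludes u < 0; symmetrically Q(u(t, x), rho+(t))
   is nonnegative, which excludes u > 1. *)
Require Import Defs.
From HB Require Import structures.
From mathcomp Require Import all_boot all_order all_algebra.
From mathcomp Require Import all_classical all_reals all_analysis.
From mathcomp Require Import measurable_realfun ess_sup_inf ring lra.

Set Implicit Arguments.
Unset Strict Implicit.
Unset Printing Implicit Defensive.

Import Order.TTheory GRing.Theory Num.Theory.
Import numFieldNormedType.Exports.

Local Open Scope classical_set_scope.
Local Open Scope ring_scope.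

(** * Calculus of C^k functions *)

(** The obstacle is the bookkeeping of null sets. Each profile in x tested in the entropy inequality
    has its own null set of times, whereas the conclusion needs a single one. Hence the profiles
    form a countable family, given by rational endpoints and an integer sharpness, and pointwise
    values are recovered by Lebesgue differentiation along rational intervals only.

    The hypotheses integrate [u] itself, which is known only up to null sets and is essentially
    bounded. The integrals are first transferred to a representative [w] that is measurable and
    bounded everywhere, for which Fubini and slicing need no further care.

    The boundary conditions hold after integration in t and for almost every distance r to the
    boundary. No trace of [u] is constructed: averaging over a short interval near the boundary
    avoids the exceptional r, and the ordering of averages carries the sign to the interior. *)

Section Ck_calculus.
Context {R : realType}.
Implicit Types V : normedModType R.

Lemma Ck_continuous V k (f : V -> R) : Ck k f -> continuous f.
Proof. by case: k => [|k] []. Qed.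

Lemma CkS V k (f : V -> R) : Ck k.+1 f -> Ck k f.
Proof.
elim: k f => [|k IH] f [cf df]; split => // v.
by have [? ?] := df v; split => //; exact: IH.
Qed.

Lemma Ck_cst V k (c : R) : Ck k (cst c : V -> R).
Proof.
elim: k c => [|k IH] c; split => //; try exact: cst_continuous.
move=> v; split => [x|]; first exact: derivable_cst.
by rewrite (_ : 'D_v (cst c) = cst 0)//; apply/funext => x; rewrite derive_cst.
Qed.

Lemma CkD V k (f g : V -> R) : Ck k f -> Ck k g -> Ck k (f + g).
Proof.
elim: k f g => [|k IH] f g [cf df] [cg dg]; split => //;
  try by move=> x; apply: cvgD; [exact: cf|exact: cg].
move=> v; have [df1 df2] := df v; have [dg1 dg2] := dg v; split=> [x|].
  exact: derivableD.
rewrite (_ : 'D_v (f + g) = 'D_v f + 'D_v g); first exact: IH.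
by apply/funext => x; rewrite deriveD.
Qed.

Lemma CkM V k (f g : V -> R) : Ck k f -> Ck k g -> Ck k (f * g).
Proof.
elim: k f g => [|k IH] f g Cf Cg.
  by case: Cf Cg => cf _ [cg _]; split => // x; apply: cvgM; [exact: cf|exact: cg].
have [cf df] := Cf; have [cg dg] := Cg; split.
  by move=> x; apply: cvgM; [exact: cf|exact: cg].
move=> v; have [df1 df2] := df v; have [dg1 dg2] := dg v; split=> [x|].
  exact: derivableM.
rewrite (_ : 'D_v (f * g) = f * 'D_v g + g * 'D_v f).
  by apply: CkD; apply: IH => //; exact: CkS.
by apply/funext => x; rewrite deriveM.
Qed.

Lemma CkZ V k (c : R) (f : V -> R) : Ck k f -> Ck k (fun x => c * f x).
Proof. by move=> Cf; apply: (@CkM _ _ (cst c) f) => //; exact: Ck_cst. Qed.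

Lemma CkB V k (f g : V -> R) : Ck k f -> Ck k g -> Ck k (fun x => f x - g x).
Proof.
move=> Cf Cg; rewrite (_ : (fun x => _) = f + (fun x => -1 * g x)).
  by apply: CkD => //; exact: CkZ.
by apply/funext => x /=; rewrite fctE mulN1r.
Qed.

Lemma Ck_ext V k (f g : V -> R) : f =1 g -> Ck k f -> Ck k g.
Proof. by move=> /funext ->. Qed.

(** Needed even on the line, because [Ck] quantifies over every direction [v] and not only over
    [1]. *)
Lemma is_derive_dir (f : R -> R) (x v df : R) :
  is_derive x 1 f df -> is_derive x v f (v * df).
Proof.
move=> dfx; have /derivable1_diffP fx := @ex_derive _ _ _ _ _ _ _ dfx.
apply: DeriveDef; first exact: diff_derivable.
rewrite deriveE// -[v in 'd _ _ v]mulr1 linearZ/= -deriveE//.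
by rewrite derive_val.
Qed.

Lemma Ck_SI k (f f' : R -> R) :
  (forall x : R, is_derive x 1 f (f' x)) -> Ck k f' -> Ck k.+1 f.
Proof.
move=> ff' Cf'; split.
  by move=> x; apply: differentiable_continuous; apply/derivable1_diffP.
move=> v; split=> [x|]; first by have [] := is_derive_dir v (ff' x).
rewrite (_ : 'D_v f = fun x => v * f' x); first exact: CkZ.
by apply/funext => x; have [_ ->] := is_derive_dir v (ff' x).
Qed.

Lemma Ck_is_derive k (f : R -> R) (x : R) : Ck k.+1 f -> is_derive x 1 f (f^`()%classic x).
Proof. by move=> [_ /(_ 1)[df _]]; rewrite derive1E; exact/derivableP. Qed.

Lemma Ck_derive1 k (f : R -> R) : Ck k.+1 f -> Ck k (f^`()%classic).
Proof.
by move=> [_ /(_ 1)[_]]; rewrite (_ : 'D_1 f = f^`()%classic)//;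
   apply/funext => x; rewrite derive1E.
Qed.

Lemma Ck_id k : Ck k (@idfun R).
Proof.
case: k => [|k]; first by split => // x; exact: cvg_id.
by apply: (@Ck_SI _ _ (cst 1)); exact: Ck_cst.
Qed.

Lemma is_derive_linear V (l : {linear V -> R}) (f : R -> R) (x v : V) df :
  is_derive (l x) 1 f df -> is_derive x v (f \o l) (l v * df).
Proof.
move=> /(is_derive_dir (l v))[dfx <-].
have E : (fun h : R => h^-1 *: ((f \o l \o shift x) (h *: v) - (f \o l) x)) =
         (fun h : R => h^-1 *: ((f \o shift (l x)) (h *: l v) - f (l x))).
  by apply/funext => h /=; rewrite linearP.
by apply: DeriveDef; rewrite /derivable /derive E.
Qed.

Lemma Ck_linear V k (l : {linear V -> R}) (f : R -> R) :
  continuous l -> Ck k f -> Ck k (f \o l).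
Proof.
move=> cl; elim: k f => [|k IH] f Cf.
  split => // x; apply: continuous_comp; first exact: cl.
  exact: Ck_continuous Cf _.
split.
  move=> x; apply: continuous_comp; first exact: cl.
  exact: Ck_continuous Cf _.
move=> v; have H x := is_derive_linear v (Ck_is_derive (l x) Cf).
split=> [x|]; first by have [] := H x.
rewrite (_ : 'D_v _ = fun x => l v * (f^`()%classic \o l) x).
  by apply: CkZ; apply: IH; exact: Ck_derive1.
by apply/funext => x; have [_ ->] := H x.
Qed.

Lemma Ck_fst k (f : R -> R) : Ck k f -> Ck k (fun p : R * R => f p.1).
Proof. by apply: (@Ck_linear _ _ fst) => x; exact: cvg_fst. Qed.

Lemma Ck_snd k (f : R -> R) : Ck k f -> Ck k (fun p : R * R => f p.2).
Proof. by apply: (@Ck_linear _ _ snd) => x; exact: cvg_snd. Qed.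

End Ck_calculus.

(** * Smooth bumps *)

Section flat_functions.
Context {R : realType}.
Implicit Types (P : {poly R}) (x y : R).

(** [flat 1] is the classical smooth function that vanishes on the negative half-line. The
    polynomial factor makes the family stable under differentiation, so that smoothness follows by
    induction on [k]. *)
Definition flat P y : R := if 0 < y then P.[y^-1] * expR (- y^-1) else 0.

(** Each monomial is controlled by x^i <= i! e^x, a single term of the exponential series; this
    gives the constant. *)
Lemma poly_expRN_bounded P :
  exists2 C, 0 <= C & forall x, 0 <= x -> `|P.[x] * expR (- x)| <= C.
Proof.
exists (\sum_(i < size P) `|P`_i| * i`!%:R) => [|x x0].
  by apply: sumr_ge0 => i _; rewrite mulr_ge0.
rewrite normrM (ger0_norm (expR_ge0 _)) expRN ler_pdivrMr ?expR_gt0//.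
rewrite horner_coef (le_trans (ler_norm_sum _ _ _))// mulr_suml ler_sum// => i _.
rewrite normrM -mulrA ler_wpM2l// ger0_norm ?exprn_ge0//.
case: i => -[|i] _ /=; first by rewrite expr0 fact0 mul1r -expR0 ler_expR.
rewrite mulrC -ler_pdivrMr ?ltr0n ?fact_gt0//.
by apply: le_trans (expR_ge1Dxn i x0); rewrite lerDr.
Qed.

(** The previous bound, applied to ['X^2 * P] at the inverse of y, gains a factor y^2. A quadratic
    bound is what makes the derivative at 0 vanish. *)
Lemma flat_le_sqr P : exists2 C, 0 <= C & forall y, `|flat P y| <= C * y ^+ 2.
Proof.
have [C C0 PC] := poly_expRN_bounded ('X^2 * P).
exists C => // y; rewrite /flat; case: ifPn => y0; last first.
  by rewrite normr0 mulr_ge0// sqr_ge0.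
have yi : 0 <= y^-1 by rewrite invr_ge0 ltW.
have := PC _ yi; rewrite hornerM hornerXn -mulrA normrM.
by rewrite ger0_norm ?exprn_ge0// exprVn mulrC ler_pdivrMr ?exprn_gt0.
Qed.

Lemma is_derive_flat P y :
  is_derive y 1 (flat P) (flat ('X^2 * (P - P^`())) y).
Proof.
have [y0|y0|->] := ltgtP y 0.
- apply: (@near_eq_is_derive _ _ _ (cst 0)).
    near=> z; have z0 : z < 0 by near: z; exact: lt_nbhsl.
    by rewrite /flat ltNge (ltW z0).
  by rewrite /flat ltNge (ltW y0); exact: is_derive_cst.
- have dP := is_derive_poly P y^-1.
  have dI : is_derive y 1 (fun z : R => z^-1) (- y ^- 2 *: 1).
    by apply: is_deriveV; rewrite gt_eqF.
  have dN : is_derive y^-1 1 (fun z : R => - z) (- 1).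
    by apply: is_deriveN.
  have dE := is_derive1_comp (is_derive_expR (- y^-1)) dN.
  have dM := is_derive1_comp (is_deriveM dP dE) dI.
  apply: (@near_eq_is_derive _ _ _ ((horner P * (expR \o -%R)) \o GRing.inv)).
    near=> z; have z0 : 0 < z by near: z; exact: lt_nbhsr.
    by rewrite /flat z0.
  apply: (is_derive_eq dM).
  rewrite /flat y0 !hornerE /= /GRing.scale/=.
  by field; rewrite gt_eqF.
- have [C C0 PC] := flat_le_sqr P.
  have F0 Q : flat Q 0 = 0 by rewrite /flat ltxx.
  have H : (fun h : R => h^-1 *: ((flat P \o shift 0) (h *: 1) - flat P 0))
      @ 0^' --> (0 : R).
    apply/cvgr0Pnorm_le => e e0; near=> h.
    have h0 : h != 0 by near: h; exact: nbhs_dnbhs_neq.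
    rewrite /= addr0 F0 subr0 /GRing.scale/= mulr1 normrM normfV.
    rewrite ler_pdivrMl ?normr_gt0//; apply: le_trans (PC h) _.
    rewrite -(real_normK (num_real h)) expr2 mulrA [leRHS]mulrC ler_wpM2r//.
    (* [C] may be 0, so [C + 1] is used as divisor: the difference quotient is at most e once |h| <=
       e / (C + 1). *)
    rewrite -(@ler_pM2r _ (C + 1)^-1) ?invr_gt0 ?ltr_wpDl//.
    apply: (@le_trans _ _ `|h|).
      by rewrite mulrAC ler_piMl// ler_pdivrMr ?ltr_wpDl// mul1r lerDl.
    near: h; apply: (@dnbhs0_le R) => //.
    by rewrite divr_gt0// ltr_wpDl.
  rewrite F0; apply: DeriveDef; first by apply/cvg_ex; exists 0.
  exact/cvg_lim.
Unshelve. all: by end_near. Qed.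

Lemma Ck_flat k P : Ck k (flat P).
Proof.
elim: k P => [|k IH] P; last by apply: Ck_SI (IH _); exact: is_derive_flat.
split => // x; apply: differentiable_continuous; apply/derivable1_diffP.
exact: (@ex_derive _ _ _ _ _ _ _ (is_derive_flat P x)).
Qed.

Lemma Ck_comp_affine k (f : R -> R) (a b : R) : Ck k f -> Ck k (fun x => f (a * x + b)).
Proof.
have cl : continuous (fun x => a * x + b).
  by move=> x; apply: cvgD; [exact: mulrl_continuous|exact: cvg_cst].
elim: k f => [|k IH] f Cf.
  by split => // x; apply: continuous_comp; [exact: cl|exact: Ck_continuous Cf _].
apply: (@Ck_SI _ _ _ (fun x => a * f^`()%classic (a * x + b))).
  move=> x; have d1 : is_derive x 1 (fun x : R => a * x + b) a.
    have d := is_deriveD (is_deriveM (is_derive_cst a x 1) (is_derive_id x 1))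
      (is_derive_cst b x 1).
    by apply: (is_derive_eq d); rewrite addr0 scaler0 addr0 /GRing.scale/= mulr1.
  have dc := @is_derive1_comp _ f _ x _ _ (Ck_is_derive _ Cf) d1.
  by rewrite mulrC; exact: dc.
by apply: CkZ; apply: IH; exact: Ck_derive1.
Qed.

(** The factor [n.+1] sharpens the bump: for y > 0, exp(- 1 / ((n + 1) y)) tends to 1, so the humps
    tend to the indicator of []p, q[] while keeping the same support. *)
Definition hump (n : nat) (p q x : R) : R :=
  flat 1 (n.+1%:R * (x - p)) * flat 1 (n.+1%:R * (q - x)).

Lemma Ck_hump k n p q : Ck k (hump n p q).
Proof.
apply: (@Ck_ext _ _ _ ((fun x => flat 1 (n.+1%:R * x + (- n.+1%:R * p)))
   * (fun x => flat 1 (- n.+1%:R * x + n.+1%:R * q)))).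
  move=> x; rewrite /hump fctE; congr (flat 1 _ * flat 1 _).
    by rewrite mulrBr mulNr.
  by rewrite mulrBr mulNr addrC.
by apply: CkM; apply: Ck_comp_affine; exact: Ck_flat.
Qed.

Lemma flat1_ge0_le1 y : 0 <= flat 1 y <= 1.
Proof.
rewrite /flat; case: ifPn => y0; last by rewrite lexx ler01.
rewrite hornerC mul1r expR_ge0/= -expR0 ler_expR oppr_le0 invr_ge0 ltW//.
Qed.

Lemma hump_ge0 n p q x : 0 <= hump n p q x.
Proof. by rewrite mulr_ge0//; have /andP[] := flat1_ge0_le1 (n.+1%:R * (x - p));
 have /andP[] := flat1_ge0_le1 (n.+1%:R * (q - x)). Qed.

Lemma hump_le1 n p q x : hump n p q x <= 1.
Proof. by rewrite -[leRHS]mulr1 ler_pM//;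
 have /andP[] := flat1_ge0_le1 (n.+1%:R * (x - p));
 have /andP[] := flat1_ge0_le1 (n.+1%:R * (q - x)). Qed.

Lemma hump_gt0 n p q x : (0 < hump n p q x) = (p < x < q).
Proof.
apply/idP/idP => [|/andP[px xq]].
  apply: contraTT; rewrite negb_and -!leNgt /hump /flat => /orP[xp|qx].
    by rewrite [X in X * _](_ : _ = 0) ?mul0r// ifF// pmulr_rgt0// subr_gt0 ltNge xp.
  by rewrite [X in _ * X](_ : _ = 0) ?mulr0// ifF// pmulr_rgt0// subr_gt0 ltNge qx.
by rewrite mulr_gt0// /flat !pmulr_rgt0 ?subr_gt0// ?px ?xq hornerC mul1r expR_gt0.
Qed.

Lemma hump_eq0 n p q x : ~~ (p < x < q) -> hump n p q x = 0.
Proof.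
rewrite -(hump_gt0 n) lt_neqAle hump_ge0 andbT negbK => /eqP/esym //.
Qed.

Lemma hump_cvg p q x : hump n p q x @[n --> \oo] --> (\1_`]p, q[ x : R).
Proof.
rewrite indicE; have [|] := boolP (p < x < q); last first.
  move=> pxq; rewrite memNset/=; last by rewrite in_itv/=; apply/negP.
  by apply: cvg_near_cst; apply: nearW => n; exact: hump_eq0.
move=> /andP[px xq]; rewrite mem_set/= ?in_itv/= ?px ?xq//.
have fl y : 0 < y -> flat 1 (n.+1%:R * y) @[n --> \oo] --> (1 : R).
  move=> y0; rewrite (_ : (fun n => _) = fun n : nat => expR (- (y^-1 * n.+1%:R^-1))).
    rewrite -[X in _ --> X]expR0; apply: continuous_cvg; first exact: continuous_expR.
    rewrite -oppr0; apply: cvgN; rewrite -(mulr0 y^-1); apply: cvgMr.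
    exact: cvg_harmonic.
  apply/funext => n; rewrite /flat pmulr_rgt0// y0 hornerC mul1r.
  by rewrite invfM mulrC.
by rewrite -[X in _ --> X]mulr1; apply: cvgM; apply: fl; rewrite subr_gt0.
Qed.

End flat_functions.

(** * Antiderivatives, smooth ramps and trapezoids *)

Section antiderivative.
Context {R : realType}.
Implicit Types (f F : R -> R).
Notation mu := (leb R).

Lemma is_derive_continuous F f : (forall x : R, is_derive x 1 F (f x)) -> continuous F.
Proof.
by move=> Ff x; apply: differentiable_continuous; apply/derivable1_diffP.
Qed.

Lemma mean_value F f (a b : R) : (forall x : R, is_derive x 1 F (f x)) -> a < b ->
  exists2 c, a < c < b & F b - F a = f c * (b - a).
Proof.
move=> Ff ab; have [|c] := @MVT _ F f a b ab (fun x _ => Ff x).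
  by apply: continuous_subspaceT; exact: is_derive_continuous Ff.
by rewrite in_itv/= => cab ->; exists c.
Qed.

Lemma continuous_integrable_itv f (a b : R) : continuous f ->
  mu.-integrable `[a, b] (EFin \o f).
Proof.
by move=> cf; apply: continuous_compact_integrable;
  [exact: segment_compact|exact: continuous_subspaceT].
Qed.

Lemma antiderivative f : continuous f -> exists F, forall x : R, is_derive x 1 F (f x).
Proof.
move=> cf; pose G a x := \int[mu]_(t in `[a, x]) f t.
have GB a b c : a <= b -> b <= c -> G a c = G a b + G b c.
  move=> ab bc; apply/eqP; rewrite addrC -subr_eq /G Rintegral_itvB//; last first.
    exact: continuous_integrable_itv.
  rewrite Rintegral_itv_obnd_cbnd//.
  by apply: integrableS (continuous_integrable_itv b c cf) => //;
    exact: subset_itv_oc_cc.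
exists (fun x => if 0 <= x then G 0 x else - G x 0) => x.
(* A base point below both 0 and x: near x the two branches of the candidate are the same function
   [G a] minus the constant [G a 0]. *)
pose a := Num.min 0 x - 1.
have a0 : a < 0 by rewrite subr_lt0 (@le_lt_trans _ _ 0) ?ltr01// ge_min lexx.
have ax : a < x by rewrite ltrBlDr (@le_lt_trans _ _ x) ?ltrDl// ge_min lexx orbT.
apply: (@near_eq_is_derive _ _ _ (G a - cst (G a 0))).
  near=> y; have ay : a < y by near: y; exact: lt_nbhsr.
  rewrite /= !fctE; case: leP => y0.
    by rewrite (GB a 0 y) ?(ltW a0)// addrC addKr.
  by rewrite (GB a y 0) ?ltW// opprD addrA subrr sub0r.
have [dG Gx] : derivable (G a) x 1 /\ (G a)^`()%classic x = f x.
  apply: (@continuous_FTC1_closed _ f a x (x + 1)) => //; last exact: cf.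
    by rewrite ltrDl.
  exact: continuous_integrable_itv.
have dGx : is_derive x 1 (G a) (f x) by rewrite -Gx derive1E; exact/derivableP.
by apply: (is_derive_eq (is_deriveB dGx (is_derive_cst _ x 1))); rewrite subr0.
Unshelve. all: by end_near. Qed.

Lemma integral_is_derive F f (a b : R) : continuous f -> a < b ->
  (forall x : R, is_derive x 1 F (f x)) ->
  \int[mu]_(x in `[a, b]) f x = F b - F a.
Proof.
move=> cf ab Ff; rewrite /Rintegral (@continuous_FTC2 _ f F)//.
- exact: continuous_subspaceT.
- have cF := is_derive_continuous Ff.
  split => [x _||]; first exact: (@ex_derive _ _ _ _ _ _ _ (Ff x)).
  + by apply: cvg_at_right_filter; exact: cF.
  + by apply: cvg_at_left_filter; exact: cF.
- by move=> x _; rewrite derive1E; have [_ ->] := Ff x.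
Qed.

Definition hump_mass n (p q : R) := \int[mu]_(x in `[p, q]) hump n p q x.

(** The ramp is the normalised primitive of the hump. Its derivative is an averaging kernel on []p,
    q[], which is how slopes of test functions become averages. *)
Lemma ramp n (p q : R) : p < q -> 0 < hump_mass n p q /\ exists E : R -> R,
  [/\ forall x : R, is_derive x 1 E (hump n p q x / hump_mass n p q),
   forall x, 0 <= E x <= 1,
   forall x, x <= p -> E x = 0 & forall x, q <= x -> E x = 1].
Proof.
move=> pq; have cb : continuous (hump n p q) by exact: Ck_continuous (Ck_hump 0 n p q).
have [F Fb] := antiderivative cb.
have mE : hump_mass n p q = F q - F p by exact: integral_is_derive.
have F_cst a b : a < b -> (forall x, a < x < b -> ~~ (p < x < q)) -> F b = F a.
  move=> ab H; have [c cab /eqP] := mean_value Fb ab.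
  by rewrite hump_eq0 ?H// mul0r subr_eq0 => /eqP.
have F_ndecr a b : a <= b -> F a <= F b.
  rewrite le_eqVlt => /predU1P[->//|ab]; have [c cab cE] := mean_value Fb ab.
  by rewrite -subr_ge0 cE mulr_ge0 ?hump_ge0// subr_ge0 ltW.
have Fp x : x <= p -> F x = F p.
  rewrite le_eqVlt => /predU1P[->//|xp]; apply/esym/F_cst => // y /andP[_ yp].
  by rewrite negb_and -!leNgt (ltW yp).
have Fq x : q <= x -> F x = F q.
  rewrite le_eqVlt => /predU1P[->//|xq]; apply/F_cst => // y /andP[qy _].
  by rewrite negb_and -!leNgt (ltW qy) orbT.
have Fpq x : F p <= F x <= F q.
  have [xp|px] := leP x p; first by rewrite (Fp x)// lexx F_ndecr// ltW.
  have [xq|xq] := leP q x; first by rewrite (Fq x)// lexx F_ndecr// ltW.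
  by rewrite !F_ndecr// ltW.
have m0 : 0 < hump_mass n p q.
  have [c cpq cE] := mean_value Fb pq.
  by rewrite mE cE mulr_gt0 ?subr_gt0// hump_gt0.
split => //; exists (fun x => (hump_mass n p q)^-1 * (F x - F p)); split.
- move=> x; have := is_deriveZ (hump_mass n p q)^-1
    (is_deriveB (Fb x) (is_derive_cst (F p) x 1)).
  by rewrite subr0 /GRing.scale/= mulrC.
- move=> x; have /andP[px xq] := Fpq x.
  rewrite ler_pdivrMl// mulr1 mulr_ge0 ?subr_ge0 ?invr_ge0 ?(ltW m0)//= mE.
  by rewrite lerB.
- by move=> x xp; rewrite (Fp x)// subrr mulr0.
- by move=> x xq; rewrite (Fq x)// -mE mulVf// gt_eqF.
Qed.

(** The difference of two ramps, rising on [[p, q]] and falling on [[r, s]]. Integrating against its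
    derivative compares an average over the first interval with one over the second. *)
Lemma trapezoid n (p q r s : R) : p < q -> q <= r -> r < s -> exists b : R -> R,
  [/\ forall k, Ck k b, forall x, 0 <= b x, forall x, ~~ (p <= x <= s) -> b x = 0 &
      forall x : R, is_derive x 1 b
        (hump n p q x / hump_mass n p q - hump n r s x / hump_mass n r s)].
Proof.
move=> pq qr rs; have [_ [E1 [dE1 E101 E1p E1q]]] := ramp n pq.
have [_ [E2 [dE2 E201 E2r E2s]]] := ramp n rs.
have db (x : R) := is_deriveB (dE1 x) (dE2 x).
exists (E1 - E2); split => //.
- move=> k; apply: CkS; apply: (Ck_SI db); apply: CkB.
    apply: (@Ck_ext _ _ _ (fun x => (hump_mass n p q)^-1 * hump n p q x)).
      by move=> x; rewrite mulrC.
    by apply: CkZ; exact: Ck_hump.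
  apply: (@Ck_ext _ _ _ (fun x => (hump_mass n r s)^-1 * hump n r s x)).
    by move=> x; rewrite mulrC.
  by apply: CkZ; exact: Ck_hump.
- move=> x; rewrite fctE /= subr_ge0.
  have [xr|rx] := leP x r; first by rewrite E2r//; have /andP[] := E101 x.
  by rewrite (E1q x) ?(le_trans qr (ltW rx))//; have /andP[] := E201 x.
- move=> x; rewrite negb_and -!ltNge !fctE /= => /orP[xp|sx].
    by rewrite E1p ?ltW// E2r ?subrr//; lra.
  by rewrite E2s ?ltW// E1q ?subrr//; lra.
Qed.

End antiderivative.

(** * Integrals of bounded measurable functions *)

Section almost_everywhere.
Context d (T : measurableType d) (R : realType) (mu : {measure set T -> \bar R}).

Lemma ae_imp (P Q : T -> Prop) : (forall x, P x -> Q x) ->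
  {ae mu, forall x, P x} -> {ae mu, forall x, Q x}.
Proof. by move=> PQ; have F := ae_filter_ringOfSetsType mu; exact: filterS. Qed.

Lemma ae_and (P Q : T -> Prop) :
  {ae mu, forall x, P x} -> {ae mu, forall x, Q x} -> {ae mu, forall x, P x /\ Q x}.
Proof.
by move=> aP aQ; have F := ae_filter_ringOfSetsType mu; exact: filterI.
Qed.

Lemma ae_forall_countable (I : countType) (P : I -> T -> Prop) :
  (forall i, {ae mu, forall x, P i x}) -> {ae mu, forall x, forall i, P i x}.
Proof.
move=> aP.
have : {ae mu, forall x, forall n, if unpickle n is Some i then P i x else True}.
  apply: ae_foralln => n; case: (unpickle n) => [i|]; first exact: aP.
  exact: aeW.
by apply: ae_imp => x H i; have := H (pickle i); rewrite pickleK.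
Qed.

End almost_everywhere.

Section bounded_measurable.
Context {R : realType}.
Notation mu := (leb R).
Implicit Types f g H : R -> R.

(** The bound holds everywhere, not just almost everywhere, so that slices and integrals over
    bounded intervals cause no exceptional sets. *)
Definition bmeas f := measurable_fun setT f /\ exists M : R, forall x, `|f x| <= M.

Lemma bmeas_cst (c : R) : bmeas (cst c).
Proof. by split => //; exists `|c|. Qed.

Lemma bmeasD f g : bmeas f -> bmeas g -> bmeas (fun x => f x + g x).
Proof.
move=> [mf [M fM]] [mg [N gN]]; split; first exact: measurable_funD.
by exists (M + N) => x; apply: le_trans (ler_normD _ _) _; rewrite lerD.
Qed.

Lemma bmeasM f g : bmeas f -> bmeas g -> bmeas (fun x => f x * g x).
Proof.
move=> [mf [M fM]] [mg [N gN]]; split; first exact: measurable_funM.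
by exists (M * N) => x; rewrite normrM ler_pM.
Qed.

Lemma bmeasN f : bmeas f -> bmeas (fun x => - f x).
Proof.
move=> [mf [M fM]]; split; first exact: measurableT_comp.
by exists M => x; rewrite normrN.
Qed.

Lemma bmeas_hump n p q : bmeas (hump n p q).
Proof.
split.
  by apply: continuous_measurable_fun; exact: Ck_continuous (Ck_hump 0 n p q).
by exists 1 => x; rewrite ger0_norm ?hump_ge0 ?hump_le1.
Qed.

Lemma bmeas_integrable f (A : set R) : measurable A -> (mu A < +oo)%E -> bmeas f ->
  mu.-integrable A (EFin \o f).
Proof.
move=> mA Aoo [mf [M fM]]; apply: measurable_bounded_integrable => //.
  exact: measurable_funS mf.
by exists M; split => [|x Mx y _ /=]; [exact: num_real|exact: le_trans (fM y) (ltW Mx)].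
Qed.

Lemma lebesgue_measure_itv_lty (b1 b2 : bool) (p q : R) :
  (mu [set` Interval (BSide b1 p) (BSide b2 q)] < +oo)%E.
Proof. by rewrite lebesgue_measure_itv; case: ifP => _; rewrite ?ltry// -EFinD ltry. Qed.

Lemma bmeas_integrable_itv f (b1 b2 : bool) (p q : R) : bmeas f ->
  mu.-integrable [set` Interval (BSide b1 p) (BSide b2 q)] (EFin \o f).
Proof. by apply: bmeas_integrable => //; exact: lebesgue_measure_itv_lty. Qed.

Lemma bmeas_locally_integrable f : bmeas f -> locally_integrable setT f.
Proof.
move=> bf; split => //; [by case: bf|exact: openT|move=> K _ cK].
have mK : measurable K by exact: compact_measurable.
have := bmeas_integrable mK (compact_finite_measure cK) bf.
by move=> /integrableP[].
Qed.

Lemma Rintegral_support (D A : set R) f : A `<=` D ->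
  (forall x, D x -> ~ A x -> f x = 0) ->
  \int[mu]_(x in D) f x = \int[mu]_(x in A) f x.
Proof.
move=> AD f0; rewrite Rintegral_mkcond [RHS]Rintegral_mkcond.
congr Rintegral; apply/funext => x; rewrite /patch.
have [xA|xA] := pselect (A x); first by rewrite !mem_set//; exact: AD.
rewrite [x \in A]memNset//; have [xD|xD] := pselect (D x).
  by rewrite mem_set// f0.
by rewrite memNset.
Qed.

Lemma hump_cvg_integral f p q : bmeas f ->
  (\int[mu]_(x in `[p, q]) (hump n p q x * f x)) @[n --> \oo] -->
  \int[mu]_(x in `]p, q[) f x.
Proof.
move=> bf; rewrite (_ : Rintegral mu _ f = \int[mu]_(x in `[p, q]) (\1_`]p, q[ x * f x)).
  have [M fM] := bf.2.
  have b1 : bmeas (\1_`]p, q[).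
    split => //; exists 1 => x; rewrite indicE; case: (_ \in _) => /=.
      by rewrite normr1. by rewrite normr0.
  have [] := @dominated_convergence _ _ _ mu `[p, q] _
    (fun n x => (hump n p q x * f x)%:E) (fun x => (\1_`]p, q[ x * f x)%:E) (cst M%:E).
  - by [].
  - move=> n; apply/measurable_EFinP.
    by have [m _] := bmeasM (bmeas_hump n p q) bf; exact: measurable_funS m.
  - by apply/measurable_EFinP; have [m _] := bmeasM b1 bf; exact: measurable_funS m.
  - apply: aeW => x _; apply/fine_cvgP; split; first by apply: nearW.
    by apply: cvgM; [exact: hump_cvg|exact: cvg_cst].
  - by apply: bmeas_integrable_itv; exact: bmeas_cst.
  - apply: aeW => x n _; rewrite lee_fin normrM ger0_norm ?hump_ge0//.
    by rewrite -[leRHS]mul1r ler_pM ?hump_ge0 ?hump_le1.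
  move=> if1 _; rewrite -[X in _ --> X -> _]fineK; last exact: integrable_fin_num.
  by move=> /fine_cvg.
rewrite [RHS](@Rintegral_support _ `]p, q[).
- by apply: eq_Rintegral => x xpq; rewrite indicE xpq mul1r.
- exact: subset_itv_oo_cc.
- by move=> x _ xpq; rewrite indicE memNset// mul0r.
Qed.

Lemma Rintegral_itv_cst p q (c : R) : p < q -> \int[mu]_(x in `]p, q[) c = c * (q - p).
Proof. by move=> pq; rewrite Rintegral_cst//= lebesgue_measure_itv/= lte_fin pq. Qed.

Lemma hump_mass_cvg p q : p < q -> hump_mass n p q @[n --> \oo] --> (q - p : R).
Proof.
move=> pq; rewrite -[X in _ --> X]mul1r -Rintegral_itv_cst//.
have := @hump_cvg_integral (cst 1) p q (bmeas_cst 1).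
by under eq_cvg do under eq_Rintegral do rewrite mulr1.
Qed.

Definition avg f p q := (\int[mu]_(x in `]p, q[) f x) / (q - p).

(** Rational endpoints make the intervals countable in number without losing Lebesgue
    differentiation. The choice of [P] and [Q] does not depend on [f]; only the null set does. *)
Lemma rational_nicely_shrinking : exists P Q : R -> nat -> rat,
 [/\ forall x n, ratr (P x n) < x < ratr (Q x n),
  forall x, (ratr (P x n) : R) @[n --> \oo] --> x,
  forall x, (ratr (Q x n) : R) @[n --> \oo] --> x &
  forall f, bmeas f -> {ae mu, forall x,
    avg f (ratr (P x n)) (ratr (Q x n)) @[n --> \oo] --> f x}].
Proof.
pose d n : R := n.+1%:R^-1.
have d0 n : 0 < d n by rewrite /d invr_gt0.
have cd c : c * d n @[n --> \oo] --> (0 : R).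
  by rewrite -(mulr0 c); apply: cvgMr; exact: cvg_harmonic.
have /choice[P HP] : forall xn : R * nat, exists p : rat,
    xn.1 - 2 * d xn.2 < ratr p < xn.1 - d xn.2.
  move=> [x n] /=; have [|p] := @rat_in_itvoo R (x - 2 * d n) (x - d n).
    by rewrite ltrD2l ltrN2 ltr_pMl// ltr1n.
  by rewrite in_itv/=; exists p.
have /choice[Q HQ] : forall xn : R * nat, exists p : rat,
    xn.1 + d xn.2 < ratr p < xn.1 + 2 * d xn.2.
  move=> [x n] /=; have [|p] := @rat_in_itvoo R (x + d n) (x + 2 * d n).
    by rewrite ltrD2l ltr_pMl// ltr1n.
  by rewrite in_itv/=; exists p.
exists (fun x n => P (x, n)), (fun x n => Q (x, n)); split.
- move=> x n; have /andP[_ Px] := HP (x, n); have /andP[xQ _] := HQ (x, n).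
  rewrite /= in Px xQ; have := d0 n; lra.
- move=> x; apply: (@squeeze_cvgr _ _ _ _ (fun n => x + -2 * d n) (fun=> x)).
  + apply: nearW => n; have /andP[Px1 Px2] := HP (x, n); rewrite /= in Px1 Px2.
    have := d0 n; lra.
  + by rewrite -[X in _ --> X]addr0; apply: cvgD; [exact: cvg_cst|exact: cd].
  + exact: cvg_cst.
- move=> x; apply: (@squeeze_cvgr _ _ _ _ (fun=> x) (fun n => x + 2 * d n)).
  + apply: nearW => n; have /andP[Px1 Px2] := HQ (x, n); rewrite /= in Px1 Px2.
    have := d0 n; lra.
  + exact: cvg_cst.
  + by rewrite -[X in _ --> X]addr0; apply: cvgD; [exact: cvg_cst|exact: cd].
have PQ x n : 2 * d n < ratr (Q (x, n)) - ratr (P (x, n)).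
  have /andP[_ Px] := HP (x, n); have /andP[xQ _] := HQ (x, n).
  rewrite /= in Px xQ; lra.
have PQ0 x n : (ratr (P (x, n)) : R) < ratr (Q (x, n)).
  by have := PQ x n; have := d0 n; lra.
pose E x n : set R := `]ratr (P (x, n)), ratr (Q (x, n))[%classic.
have hE x : nicely_shrinking x (E x).
  split; first by move=> n; exact: measurable_itv.
  have r0 n : 0 < 2 * d n by rewrite mulr_gt0.
  (* The interval is longer than [2 * d n] and lies in the ball of radius [2 * d n], of measure 4
     [d n]; the ratio is at most 2. *)
  exists (2, fun n => PosNum (r0 n)); split => //=.
  - move=> n y; rewrite /E /= in_itv/= /ball/= => /andP[Py yQ].
    have /andP[P1 _] := HP (x, n); have /andP[_ Q2] := HQ (x, n).
    rewrite /= in P1 Q2; rewrite distrC ltr_norml; lra.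
  - move=> n; rewrite lebesgue_measure_ball; last exact: ltW.
    rewrite lebesgue_measure_itv/= lte_fin PQ0 -EFinD -EFinM lee_fin.
    by have := PQ x n; rewrite mulr2n; lra.
move=> f bf; have lf := bmeas_locally_integrable bf.
apply: ae_imp (lebesgue_differentiation lf) => x fx.
have := nice_lebesgue_differentiation hE lf fx.
move=> /fine_cvg; apply: cvg_trans; apply: near_eq_cvg; apply: nearW => n /=.
rewrite /avg mulrC lebesgue_measure_itv/= lte_fin PQ0 -EFinD inver.
rewrite subr_eq0 gt_eqF ?PQ0//= fineM//.
by apply: integrable_fin_num; [exact: measurable_itv|exact: bmeas_integrable_itv].
Qed.

End bounded_measurable.

(** * Pointwise information from averages *)

Section pointwise_from_averages.
Context {R : realType}.
Notation mu := (leb R).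
Implicit Types f g H : R -> R.

Lemma avgE f p q : avg f p q = (\int[mu]_(x in `]p, q[) f x) / (q - p).
Proof. by []. Qed.

Lemma cvg_ge0 (f_ : nat -> R) (l : R) : f_ n @[n --> \oo] --> l ->
  (\forall n \near \oo, 0 <= f_ n) -> 0 <= l.
Proof.
move=> fl f0; rewrite -(cvg_lim (@Rhausdorff R) fl).
by apply: limr_ge => //; apply/cvg_ex; exists l.
Qed.

Lemma ae_ge0_from_rational (D : set R) f : open D -> bmeas f ->
  (forall p q : rat, (ratr p : R) < ratr q -> `[ratr p, ratr q] `<=` D ->
     0 <= \int[mu]_(x in `]ratr p, ratr q[) f x) ->
  {ae mu, forall x, D x -> 0 <= f x}.
Proof.
move=> oD bf H; have [P [Q [PxQ Px Qx PQf]]] := @rational_nicely_shrinking R.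
apply: ae_imp (PQf f bf) => x fx Dx.
have /nbhs_ballP[e /= e0 De] : nbhs x D by exact: open_nbhs_nbhs.
apply: cvg_ge0 fx _; near=> n.
have /andP[Pn Qn] := PxQ x n; have PQn := lt_trans Pn Qn.
rewrite avgE divr_ge0 ?subr_ge0 ?(ltW PQn)//; apply: H => // y /=.
rewrite in_itv/= => /andP[Py yQ]; apply: De; rewrite /ball/= ltr_norml.
have : x - e < ratr (P x n).
  by near: n; apply: cvgr_gt (Px x) _ _; rewrite ltrBlDr ltrDl.
have : ratr (Q x n) < x + e.
  by near: n; apply: cvgr_lt (Qx x) _ _; rewrite ltrDl.
lra.
Unshelve. all: by end_near. Qed.

Lemma ae_le0_from_rational (D : set R) f : open D -> bmeas f ->
  (forall p q : rat, (ratr p : R) < ratr q -> `[ratr p, ratr q] `<=` D ->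
     \int[mu]_(x in `]ratr p, ratr q[) f x <= 0) ->
  {ae mu, forall x, D x -> f x <= 0}.
Proof.
move=> oD bf H; have : {ae mu, forall x, D x -> 0 <= - f x}.
  apply: ae_ge0_from_rational (bmeasN bf) _ => // p q pq pqD.
  under eq_Rintegral do rewrite -mulN1r.
  by rewrite RintegralZl//; [rewrite mulN1r oppr_ge0 H|exact: bmeas_integrable_itv].
by apply: ae_imp => x + Dx => /(_ Dx); rewrite oppr_ge0.
Qed.

(** [G] is the set of points where the shrinking averages converge to [f]. The comparison thus holds
    for every pair taken from one set of full measure, which is stronger than for almost every
    pair. *)
Lemma nonincreasing_from_rational f : bmeas f ->
  (forall p q r s : rat, 0 < (ratr p : R) -> (ratr p : R) < ratr q ->
    (ratr q : R) <= ratr r -> (ratr r : R) < ratr s -> (ratr s : R) < 1 ->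
    avg f (ratr r) (ratr s) <= avg f (ratr p) (ratr q)) ->
  exists2 G : R -> Prop, {ae mu, forall x, G x} &
    forall x y, G x -> G y -> 0 < x -> x < y -> y < 1 -> f y <= f x.
Proof.
move=> bf H; have [P [Q [PxQ Px Qx PQf]]] := @rational_nicely_shrinking R.
eexists; first exact: PQf bf.
move=> x y /= fx fy x0 xy y1; rewrite -subr_ge0.
apply: (cvg_ge0 (cvgB fx fy)); near=> n.
have /andP[Pxn Qxn] := PxQ x n; have /andP[Pyn Qyn] := PxQ y n.
rewrite subr_ge0; apply: H; [|lra| |lra|].
- by near: n; exact: cvgr_gt (Px x) _ x0.
- have : ratr (Q x n) < (x + y) / 2.
    by near: n; apply: cvgr_lt (Qx x) _ _; lra.
  have : (x + y) / 2 < ratr (P y n).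
    by near: n; apply: cvgr_gt (Px y) _ _; lra.
  lra.
- by near: n; exact: cvgr_lt (Qx y) _ y1.
Unshelve. all: by end_near. Qed.

Lemma ae_ge0_from_humps H : bmeas H ->
  (forall n p q, 0 < p -> p < q ->
     0 <= \int[mu]_(t in `[0, +oo[) (hump n p q t * H t)) ->
  {ae mu, forall t, 0 <= t -> 0 <= H t}.
Proof.
move=> bH HH.
have H0 : {ae mu, forall t, `]0, +oo[%classic t -> 0 <= H t}.
  apply: ae_ge0_from_rational => // p q pq pqD.
  have p0 : 0 < (ratr p : R).
    by have /= := pqD (ratr p); rewrite !in_itv/= lexx (ltW pq)/= andbT; apply.
  have /cvg_ge0 := @hump_cvg_integral _ _ (ratr p) (ratr q) bH; apply.
  apply: nearW => n.
  rewrite -(@Rintegral_support _ `[0, +oo[); first exact: HH.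
    by move=> x /=; rewrite !in_itv/= andbT => /andP[/(le_trans (ltW p0))].
  move=> x _ xpq; rewrite hump_eq0 ?mul0r//; apply/negP => /andP[px xq].
  by apply: xpq; rewrite /= in_itv/= !ltW.
(* The humps are supported in t > 0, so time 0 is discarded as a null set. *)
have n0 : {ae mu, forall t : R, t <> 0}.
  exists [set 0]; split => //; first exact: lebesgue_measure_set1.
  by move=> t /=; apply: contrapT.
apply: ae_imp (ae_and H0 n0) => t [Ht t0] tge0; apply: Ht.
by rewrite /= in_itv/= andbT lt_neqAle tge0 andbT eq_sym; apply/eqP.
Qed.

(** As n grows, the two kernels tend to the normalised indicators of []p, q[] and []r, s[], and the
    assumed inequality passes to the limit by dominated convergence. *)
Lemma avg_le_from_trapezoids f p q r s : bmeas f ->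
  0 < p -> p < q -> q <= r -> r < s -> s < 1 ->
  (forall n, 0 <= \int[mu]_(x in `[0, 1]) (f x *
     (hump n p q x / hump_mass n p q - hump n r s x / hump_mass n r s))) ->
  avg f r s <= avg f p q.
Proof.
move=> bf p0 pq qr rs s1 H; rewrite -subr_ge0 !avgE.
have C a b : a < b ->
    (\int[mu]_(x in `[a, b]) (hump n a b x * f x)) / hump_mass n a b
      @[n --> \oo] --> (\int[mu]_(x in `]a, b[) f x) / (b - a).
  move=> ab; apply: cvgM; first exact: hump_cvg_integral.
  by apply: cvgV; [rewrite subr_eq0 gt_eqF|exact: hump_mass_cvg].
have S n a b : 0 < a -> a < b -> b < 1 ->
    \int[mu]_(x in `[a, b]) (hump n a b x * f x) =
    \int[mu]_(x in `[0, 1]) (hump n a b x * f x).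
  move=> a0 ab b1; rewrite -(@Rintegral_support _ `[0, 1])//.
    by move=> x /=; rewrite !in_itv/=; lra.
  move=> x _ xab; rewrite hump_eq0 ?mul0r//; apply/negP => /andP[ax xb].
  by apply: xab; rewrite /= in_itv/= !ltW.
apply: cvg_ge0 (cvgB (C _ _ pq) (C _ _ rs)) _; apply: nearW => n.
have bh a b : bmeas (fun x => hump n a b x * f x).
  by apply: bmeasM => //; exact: bmeas_hump.
have q1 : q < 1 by lra.
have r0 : 0 < r by lra.
rewrite !fctE /= (S n p q)// (S n r s)//.
have i01 g : bmeas g -> mu.-integrable `[0, 1] (EFin \o g).
  exact: bmeas_integrable_itv.
rewrite -!RintegralZr ?i01// -RintegralB//.
- suff -> : \int[mu]_(x in `[0, 1])
      (hump n p q x * f x / hump_mass n p q - hump n r s x * f x / hump_mass n r s) =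
    \int[mu]_(x in `[0, 1]) (f x *
     (hump n p q x / hump_mass n p q - hump n r s x / hump_mass n r s)) by [].
  by apply: eq_Rintegral => x _; ring.
- by apply: i01; apply: bmeasM => //; exact: bmeas_cst.
- by apply: i01; apply: bmeasM => //; exact: bmeas_cst.
Qed.

End pointwise_from_averages.

(** * Functions of two variables *)

Section two_variables.
Context {R : realType}.
Notation mu := (leb R).
Implicit Types F G : R * R -> R.

(** [G] need not be integrable, so Tonelli is applied to its positive and negative parts instead of
    Fubini to [G]. *)
Lemma measurable_Rintegral_snd (B : set R) G : measurable B -> measurable_fun setT G ->
  measurable_fun setT (fun t => \int[mu]_(x in B) G (t, x)).
Proof.
move=> mB mG; pose GB (p : R * R) := (G p * \1_B p.2)%:E.
have mGB : measurable_fun setT GB.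
  apply/measurable_EFinP; apply: measurable_funM => //.
  by apply: measurableT_comp => //; exact: measurable_indic.
have E t : (\int[mu]_(x in B) (G (t, x))%:E = \int[mu]_x GB (t, x))%E.
  rewrite integral_mkcond; apply: eq_integral => x _.
  by rewrite /GB patchE indicE/=; case: (x \in B); rewrite ?mulr1 ?mulr0.
apply: measurableT_comp => //; under eq_fun do rewrite E.
have -> : (fun t => \int[mu]_x GB (t, x))%E =
  ((fun t => \int[mu]_x GB^\+ (t, x)) \- (fun t => \int[mu]_x GB^\- (t, x)))%E.
  by apply/funext => t; rewrite [LHS]integralE funepos_comp funeneg_comp.
apply: emeasurable_funB.
  by apply: measurable_fun_fubini_tonelli_F => //; exact: measurable_funepos.
by apply: measurable_fun_fubini_tonelli_F => //; exact: measurable_funeneg.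
Qed.

Definition bmeas2 F := measurable_fun setT F /\ exists M : R, forall p, `|F p| <= M.

Lemma bmeas2_comp F (g : R -> R) : bmeas2 F -> continuous g -> bmeas2 (g \o F).
Proof.
move=> [mF [M FM]] cg; split.
  by apply: measurableT_comp => //; exact: continuous_measurable_fun.
have := @continuous_compact _ _ g `[- M, M] (continuous_subspaceT cg) (@segment_compact _ _ _).
move=> /compact_bounded[N [_ gN]]; exists (N + 1) => p.
have N1 : N < N + 1 by rewrite ltrDl.
by apply: (gN _ N1 (g (F p))); exists (F p) => //=; rewrite in_itv/= -ler_norml.
Qed.

Lemma bmeas2_fst (f : R -> R) : bmeas f -> bmeas2 (fun p => f p.1).
Proof. by move=> [mf [M fM]]; split; [exact: measurableT_comp|exists M]. Qed.

Lemma bmeas2_snd (f : R -> R) : bmeas f -> bmeas2 (fun p => f p.2).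
Proof. by move=> [mf [M fM]]; split; [exact: measurableT_comp|exists M]. Qed.

Lemma bmeas2D F G : bmeas2 F -> bmeas2 G -> bmeas2 (fun p => F p + G p).
Proof.
move=> [mf [M fM]] [mg [N gN]]; split; first exact: measurable_funD.
by exists (M + N) => x; apply: le_trans (ler_normD _ _) _; rewrite lerD.
Qed.

Lemma bmeas2M F G : bmeas2 F -> bmeas2 G -> bmeas2 (fun p => F p * G p).
Proof.
move=> [mf [M fM]] [mg [N gN]]; split; first exact: measurable_funM.
by exists (M * N) => x; rewrite normrM ler_pM.
Qed.

Lemma bmeas2_slice1 F t : bmeas2 F -> bmeas (fun x => F (t, x)).
Proof.
move=> [mF [M FM]]; split; last by exists M.
exact: measurableT_comp mF (pair1_measurable t).
Qed.

Lemma bmeas2_slice2 F x : bmeas2 F -> bmeas (fun t => F (t, x)).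
Proof.
move=> [mF [M FM]]; split; last by exists M.
exact: measurableT_comp mF (pair2_measurable x).
Qed.

Lemma bmeas2_swap F : bmeas2 F -> bmeas2 (fun p => F (p.2, p.1)).
Proof.
move=> [mF [M FM]]; split; last by exists M => p /=.
exact: measurableT_comp mF (measurable_fun_pair measurable_snd measurable_fst).
Qed.

Lemma bmeas_Rintegral_snd (b1 b2 : bool) (p q : R) F : bmeas2 F ->
  bmeas (fun t => \int[mu]_(x in [set` Interval (BSide b1 p) (BSide b2 q)]) F (t, x)).
Proof.
move=> bF; split; first by apply: measurable_Rintegral_snd => //; case: bF.
have [_ [M FM]] := bF; set B := [set` _].
have mB : measurable B by exact: measurable_itv.
exists (\int[mu]_(x in B) M) => t.
have iF : mu.-integrable B (EFin \o (fun x => F (t, x))).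
  by apply: bmeas_integrable_itv; exact: bmeas2_slice1.
apply: le_trans (le_normr_Rintegral _ iF) _ => //.
apply: le_Rintegral => //.
  exact: (integrable_norm iF).
by apply: bmeas_integrable_itv; exact: bmeas_cst.
Qed.

Lemma Rintegral_swap (a b c d : R) (b1 b2 b3 b4 : bool) F : bmeas2 F ->
  \int[mu]_(t in [set` Interval (BSide b1 a) (BSide b2 b)])
    \int[mu]_(x in [set` Interval (BSide b3 c) (BSide b4 d)]) F (t, x) =
  \int[mu]_(x in [set` Interval (BSide b3 c) (BSide b4 d)])
    \int[mu]_(t in [set` Interval (BSide b1 a) (BSide b2 b)]) F (t, x).
Proof.
set A := [set` Interval (BSide b1 a) _]; set B := [set` Interval (BSide b3 c) _].
move=> bF; pose H (p : R * R) := (\1_A p.1 * \1_B p.2 * F p)%:E.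
have mA : measurable A by exact: measurable_itv.
have mB : measurable B by exact: measurable_itv.
have iH : (mu \x mu)%E.-integrable setT H.
  have : (mu \x mu)%E.-integrable (A `*` B) (EFin \o F).
    apply: measurable_bounded_integrable.
    - exact: measurableX.
    - suff : (mu A * mu B < +oo)%E by rewrite -product_measure1E.
      apply: lte_mul_pinfty => //; last exact: lebesgue_measure_itv_lty.
      by rewrite ge0_fin_numE//; exact: lebesgue_measure_itv_lty.
    - by apply: measurable_funS bF.1.
    - have [_ [M FM]] := bF; exists M; split => [|x Mx y _ /=].
        exact: num_real.
      exact: le_trans (FM y) (ltW Mx).
  rewrite integrable_mkcond; last exact: measurableX.
  apply: eq_integrable => // -[t x] _; rewrite /H patchE in_setX !indicE /=.
  by case: (t \in A); case: (x \in B); rewrite /= ?mul1r ?mul0r ?mulr1 ?mulr0 ?mul0r.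
have E1 : (\int[mu]_(t in A) \int[mu]_(x in B) F (t, x) =
    fine (\int[mu]_t \int[mu]_x H (t, x))%E)%R.
  rewrite Rintegral_mkcond /Rintegral; congr fine; apply: eq_integral => t _.
  rewrite patchE; have [tA|tA] := boolP (t \in A); last first.
    rewrite integral0_eq// => x _; rewrite /H /= indicE (negbTE tA).
    by rewrite !mul0r.
  rewrite fineK; last first.
    apply: integrable_fin_num => //; apply: bmeas_integrable_itv.
    exact: bmeas2_slice1.
  rewrite integral_mkcond; apply: eq_integral => x _; rewrite patchE /H !indicE tA/=.
  by case: (x \in B); rewrite ?mul1r ?mul0r.
rewrite E1 Fubini// Rintegral_mkcond /Rintegral; congr fine.
apply: eq_integral => x _; rewrite patchE; have [xB|xB] := boolP (x \in B); last first.
  rewrite integral0_eq// => t _; rewrite /H /= indicE [in X in _ * X * _]indicE.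
  by rewrite (negbTE xB) mulr0 mul0r.
rewrite fineK; last first.
  apply: integrable_fin_num => //; apply: bmeas_integrable_itv.
  exact: bmeas2_slice2.
rewrite [RHS]integral_mkcond; apply: eq_integral => t _.
rewrite patchE /H !indicE xB/=.
by case: (t \in A); rewrite ?mul1r ?mul0r.
Qed.

Lemma ge0_integral0_ae (f : R -> \bar R) : measurable_fun setT f ->
  (forall x, (0 <= f x)%E) -> (\int[mu]_x f x = 0)%E -> {ae mu, forall x, f x = 0%E}.
Proof.
move=> mf f0 if0; have /(ae_eq_integral_abs mu measurableT) := mf.
move=> [H _]; have : ae_eq mu setT f (cst 0%E).
  by apply: H; rewrite -if0; apply: eq_integral => x _; rewrite gee0_abs.
by apply: ae_imp => x; apply.
Qed.

Section null_set.
Variables (N : set (measurableTypeR R * measurableTypeR R)) (mN : measurable N).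

Let f (p : measurableTypeR R * measurableTypeR R) : \bar R := (\1_N p)%:E.

Let mf : measurable_fun setT f.
Proof. by apply/measurable_EFinP; exact: measurable_indic. Qed.

Let f0 p : (0 <= f p)%E. Proof. by rewrite lee_fin. Qed.

Let ae_notin (I : R -> R * R) : measurable_fun setT I ->
  (\int[mu]_x f (I x) = 0)%E -> {ae mu, forall x, ~ N (I x)}.
Proof.
move=> mI fI0; have H : {ae mu, forall x, f (I x) = 0%E}.
  by apply: ge0_integral0_ae => //; exact: measurableT_comp mf mI.
apply: ae_imp H => x; rewrite /f indicE => -[] /eqP; rewrite pnatr_eq0 eqb0.
by move=> + Nx; rewrite mem_set.
Qed.

Lemma null_section1 : (leb2 R) N = 0%E -> {ae mu, forall t, {ae mu, forall x, ~ N (t, x)}}.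
Proof.
move=> N0; have : (\int[mu]_t \int[mu]_x f (t, x) = 0)%E.
  by rewrite -(@fubini_tonelli1 _ _ _ _ _ mu mu f)// integral_indic//= setIT.
move=> fI0; have : {ae mu, forall t, (\int[mu]_x f (t, x) = 0)%E}.
  apply: ge0_integral0_ae => //; first exact: measurable_fun_fubini_tonelli_F.
  by move=> t; exact: integral_ge0.
by apply: ae_imp => t; apply: ae_notin; exact: pair1_measurable.
Qed.

Lemma null_section2 : (leb2 R) N = 0%E -> {ae mu, forall x, {ae mu, forall t, ~ N (t, x)}}.
Proof.
move=> N0; have : (\int[mu]_x \int[mu]_t f (t, x) = 0)%E.
  by rewrite -(@fubini_tonelli2 _ _ _ _ _ mu mu f)// integral_indic//= setIT.
move=> fI0; have : {ae mu, forall x, (\int[mu]_t f (t, x) = 0)%E}.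
  apply: ge0_integral0_ae => //; first exact: measurable_fun_fubini_tonelli_G.
  by move=> x; exact: integral_ge0.
by apply: ae_imp => x; apply: (@ae_notin (fun t => (t, x))); exact: pair2_measurable.
Qed.

Lemma null_from_sections : {ae mu, forall t, {ae mu, forall x, ~ N (t, x)}} ->
  (leb2 R) N = 0%E.
Proof.
move=> H; have -> : (leb2 R) N = (\int[mu]_t \int[mu]_x f (t, x))%E.
  by rewrite -(@fubini_tonelli1 _ _ _ _ _ mu mu f)// integral_indic//= setIT.
rewrite -[RHS](@integral0 _ _ _ mu setT); apply: ae_eq_integral => //.
  exact: measurable_fun_fubini_tonelli_F.
apply: ae_imp H => t Ht _; rewrite -[RHS](@integral0 _ _ _ mu setT).
apply: ae_eq_integral => //; first exact: measurableT_comp mf (pair1_measurable t).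
by apply: ae_imp Ht => x Nx _; rewrite /f indicE memNset.
Qed.

End null_set.

Lemma ae_prod1 (P : R * R -> Prop) : {ae leb2 R, forall p, P p} ->
  {ae mu, forall t, {ae mu, forall x, P (t, x)}}.
Proof.
move=> [N [mN N0 PN]]; apply: ae_imp (null_section1 mN N0) => t.
by apply: ae_imp => x Nx; apply: contrapT => nP; apply: Nx; exact: PN.
Qed.

Lemma ae_prod2 (P : R * R -> Prop) : {ae leb2 R, forall p, P p} ->
  {ae mu, forall x, {ae mu, forall t, P (t, x)}}.
Proof.
move=> [N [mN N0 PN]]; apply: ae_imp (null_section2 mN N0) => x.
by apply: ae_imp => t Nt; apply: contrapT => nP; apply: Nt; exact: PN.
Qed.

Lemma ae_Rintegral_eq (D : set R) (f g : R -> R) : measurable D ->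
  measurable_fun D f -> measurable_fun D g -> {ae mu, forall x, D x -> f x = g x} ->
  \int[mu]_(x in D) f x = \int[mu]_(x in D) g x.
Proof.
move=> mD mf mg fg; rewrite /Rintegral; congr fine; apply: ae_eq_integral => //.
- exact/measurable_EFinP.
- exact/measurable_EFinP.
- by apply: ae_imp fg => x fgx Dx; rewrite fgx.
Qed.

Let onem_measurable : measurable_fun setT (fun x : R => 1 - x : measurableTypeR R).
Proof. exact: measurable_funB. Qed.

(** The condition at the right end is stated in [1 - r]; invariance under this reflection transports
    its exceptional set of r to one of x. *)
Lemma lebesgue_measure_onem (A : set R) : measurable A -> mu ((fun x => 1 - x) @^-1` A) = mu A.
Proof.
move=> mA; rewrite -[LHS]/(pushforward mu (fun x : R => 1 - x : measurableTypeR R) A).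
apply/esym/lebesgue_measure_unique => //= _ [[a b]] _ <-.
rewrite /pushforward (_ : _ @^-1` _ = `[1 - b, 1 - a[%classic); last first.
  by apply/seteqP; split => x /=; rewrite !in_itv/=; lra.
rewrite !lebesgue_measure_itv/= !lte_fin ltrD2l ltrN2; case: ifP => // _.
by rewrite -!EFinB; congr EFin; ring.
Qed.

Lemma ae_onem (P : R -> Prop) : {ae mu, forall r, P r} -> {ae mu, forall x, P (1 - x)}.
Proof.
move=> [N [mN N0 PN]].
exists ((fun x => 1 - x) @^-1` N); split; last by move=> x /= nP; exact: PN.
  by rewrite -[X in measurable X]setTI; exact: onem_measurable.
by rewrite lebesgue_measure_onem.
Qed.

End two_variables.

(** * Space-time test functions *)

Section reduction.
Context {R : realType}.
Notation mu := (leb R).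
Implicit Types (u w : R * R -> R) (g : R -> R).

Lemma space_time_measurable : measurable (@space_time R : set (R * R)).
Proof. by apply: measurableX; exact: measurable_itv. Qed.

(** Clipping at the essential supremum bounds the function everywhere and changes it only on a null
    set. *)
Lemma truncation u : Linfty_space_time u ->
  measurable_fun setT (u \_ (@space_time R)) /\ exists2 w, bmeas2 w &
    {ae leb2 R, forall p, space_time p -> u p = w p}.
Proof.
move=> uL; have /sub_Lfun_mfun := uL; have /sub_Lfun_finLfun := uL.
rewrite !inE /= => fu mu_; set v := u \_ _ in fu mu_ *.
have mv : measurable_fun setT v by exact: mu_.
split => //; have [M vM] : exists M, {ae leb2 R, forall p, `|v p| <= M}.
  move: fu; rewrite /finite_norm unlock /Lnorm; case: ifPn => [_|].
    set E := ess_sup _ _ => Eoo; exists (fine E).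
    have := ess_sup_ge (leb2 R) (abse \o (EFin \o v)).
    apply: ae_imp => p /=; rewrite -/E; move: Eoo.
    by case: E => //= r.
  (* The norm of exponent [+oo] is defined by cases on the total measure. If that were zero, every
     property would hold almost everywhere and any [M] would do. *)
  rewrite -leNgt => T0 _; exists 0, setT; split => //.
  by apply/eqP; rewrite eq_le T0 measure_ge0.
exists (fun p => Num.max (- M) (Num.min M (v p))).
  split.
    by apply: measurable_maxr => //; exact: measurable_minr.
  exists `|M| => p; rewrite ler_norml; apply/andP; split.
    by rewrite le_max lerN2 ler_norm.
  by rewrite ge_max -normrN ler_norm normrN ge_min ler_norm.
apply: ae_imp vM => p vpM Dp; have -> : u p = v p by rewrite /v patchE mem_set.
by move: vpM; rewrite ler_norml => /andP[Mv vM]; rewrite min_r// max_r.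
Qed.

Lemma tensor_test_function (a b : R -> R) (p q r s : R) :
  (forall k, Ck k a) -> (forall k, Ck k b) ->
  0 < p -> 0 < r -> s < 1 ->
  (forall t, ~~ (p <= t <= q) -> a t = 0) ->
  (forall x, ~~ (r <= x <= s) -> b x = 0) ->
  test_function (fun p => a p.1 * b p.2).
Proof.
move=> Ca Cb p0 r0 s1 a0 b0.
have supp : tsupport (fun p => a p.1 * b p.2) `<=` `[p, q] `*` `[r, s].
  rewrite /tsupport; have cl : closed (`[p, q] `*` `[r, s] : set (R * R)).
    rewrite (_ : _ `*` _ = fst @^-1` `[p, q] `&` snd @^-1` `[r, s])//.
    apply: closedI; apply: closed_comp => [x _|]; try exact: interval_closed.
      exact: cvg_fst.
    exact: cvg_snd.
  rewrite closureE; apply: smallest_sub => // -[t x] /= abx; split => /=; rewrite in_itv/=.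
    by apply: contraNT abx => /a0 ->; rewrite mul0r.
  by apply: contraNT abx => /b0 ->; rewrite mulr0.
split.
- by move=> k; apply: CkM; [exact: Ck_fst|exact: Ck_snd].
- apply: (subclosed_compact _ _ supp); first exact: closed_closure.
  by apply: compact_setX; exact: segment_compact.
- by apply: (subset_trans supp) => -[t x] /= [] /=; rewrite !in_itv/=; split; lra.
Qed.

(** [u] is replaced in two stages: by its extension by zero, which is measurable and agrees with [u]
    at every point of the strip, and then by [w], for almost every t and almost every x. The first
    stage supplies the measurability that the second requires. *)
Lemma flux_integral u w g (a b db : R -> R) :
  measurable_fun setT (u \_ (@space_time R)) -> bmeas2 w ->
  {ae leb2 R, forall p, space_time p -> u p = w p} ->
  continuous g -> bmeas a -> bmeas db -> (forall x : R, is_derive x 1 b (db x)) ->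
  \int[mu]_(t in `[0, +oo[) \int[mu]_(x in `[0, 1])
    (g (u (t, x)) * (fun y => a t * b y)^`()%classic x) =
  \int[mu]_(t in `[0, +oo[) (a t * \int[mu]_(x in `[0, 1]) (g (w (t, x)) * db x)).
Proof.
set v := u \_ _ => mv bw uw cg ba bdb bdb'.
have mg : measurable_fun setT g by exact: continuous_measurable_fun.
have vE t x : 0 <= t -> x \in `[0, 1]%classic -> v (t, x) = u (t, x).
  move=> t0; rewrite inE /= in_itv/= => x01.
  by rewrite /v patchE mem_set//; split; rewrite /= in_itv/= ?t0.
pose G (p : R * R) := g (v p) * (a p.1 * db p.2).
have mG : measurable_fun setT G.
  apply: measurable_funM; first exact: measurableT_comp.
  by apply: measurable_funM; apply: measurableT_comp => //; [case: ba|case: bdb].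
have dE t x : (fun y => a t * b y)^`()%classic x = a t * db x.
  have H := is_deriveZ (a t) (bdb' x).
  by rewrite derive1E; have [_ ->] := H.
transitivity (\int[mu]_(t in `[0, +oo[) \int[mu]_(x in `[0, 1]) G (t, x)).
  apply: eq_Rintegral => t; rewrite inE/= in_itv/= andbT => t0.
  by apply: eq_Rintegral => x x01; rewrite dE /G /= vE.
have bgw : bmeas2 (fun p => g (w p) * db p.2).
  by apply: bmeas2M; [exact: bmeas2_comp bw cg|exact: bmeas2_snd].
apply: ae_Rintegral_eq => //.
- apply: measurable_funS (measurable_Rintegral_snd _ mG) => //.
- apply: (@measurable_funS _ _ _ _ setT) => //.
  apply: measurable_funM; first by case: ba.
  by have [] := bmeas_Rintegral_snd true false 0 1 bgw.
apply: ae_imp (ae_prod1 uw) => t uwt t0; rewrite /= in_itv/= andbT in t0.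
rewrite -RintegralZl//; last first.
  by apply: bmeas_integrable_itv; exact: (bmeas2_slice1 t bgw).
apply: ae_Rintegral_eq => //.
- exact: measurable_funS (measurable_fun_pair2 t mG).
- apply: (@measurable_funS _ _ _ _ setT) => //; apply: measurable_funM => //.
  by have [] := bmeas2_slice1 t bgw.
- apply: ae_imp uwt => x uwx x01.
  have x01' : x \in `[0, 1]%classic by rewrite inE.
  have st : space_time (t, x) by split; [rewrite /= in_itv/= t0|].
  by rewrite /G /= (vE _ _ t0 x01') (uwx st) mulrCA.
Qed.

(** The exceptional times depend on the sharpness [n] and on the four endpoints. These indices form
    a countable type, so the null sets are merged before [n] tends to infinity at a fixed t. *)
Lemma averages_nonincreasing u w g :
  measurable_fun setT (u \_ (@space_time R)) -> bmeas2 w ->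
  {ae leb2 R, forall p, space_time p -> u p = w p} ->
  continuous g ->
  (forall phi, test_function phi -> (forall p, 0 <= phi p) ->
     0 <= \int[mu]_(t in `[0, +oo[) \int[mu]_(x in `[0, 1])
       (g (u (t, x)) * (fun y => phi (t, y))^`()%classic x)) ->
  {ae mu, forall t, 0 <= t -> forall p q r s : rat, 0 < (ratr p : R) ->
    (ratr p : R) < ratr q -> (ratr q : R) <= ratr r -> (ratr r : R) < ratr s ->
    (ratr s : R) < 1 ->
    avg (fun x => g (w (t, x))) (ratr r) (ratr s)
    <= avg (fun x => g (w (t, x))) (ratr p) (ratr q)}.
Proof.
move=> mv bw uw cg H.
pose slope n (p q r s x : R) :=
  hump n p q x / hump_mass n p q - hump n r s x / hump_mass n r s.
have bslope n p q r s : bmeas (slope n p q r s).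
  apply: (@bmeasD _ (fun x => hump n p q x / hump_mass n p q)).
    by apply: bmeasM; [exact: bmeas_hump|exact: bmeas_cst].
  by apply: bmeasN; apply: bmeasM; [exact: bmeas_hump|exact: bmeas_cst].
have : {ae mu, forall t, forall i : nat * (rat * rat * rat * rat),
    let: (n, (p, q, r, s)) := i in
    0 < (ratr p : R) -> (ratr p : R) < ratr q -> (ratr q : R) <= ratr r ->
    (ratr r : R) < ratr s -> (ratr s : R) < 1 -> 0 <= t ->
    0 <= \int[mu]_(x in `[0, 1]) (g (w (t, x)) *
       slope n (ratr p) (ratr q) (ratr r) (ratr s) x)}.
  apply: ae_forall_countable => -[n [[[p q] r] s]].
  have [p0|] := boolP (0 < (ratr p : R)); last by move=> _; exact: aeW.
  have [pq|] := boolP ((ratr p : R) < ratr q); last by move=> _; exact: aeW.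
  have [qr|] := boolP ((ratr q : R) <= ratr r); last by move=> _; exact: aeW.
  have [rs|] := boolP ((ratr r : R) < ratr s); last by move=> _; exact: aeW.
  have [s1|] := boolP ((ratr s : R) < 1); last by move=> _; exact: aeW.
  have [b [Cb b0 bsupp db]] := trapezoid n pq qr rs.
  have : {ae mu, forall t, 0 <= t -> 0 <= \int[mu]_(x in `[0, 1]) (g (w (t, x)) *
       slope n (ratr p) (ratr q) (ratr r) (ratr s) x)}.
    apply: ae_ge0_from_humps.
      apply: (@bmeas_Rintegral_snd _ true false 0 1
        (fun p => g (w p) * slope n _ _ _ _ p.2)).
      by apply: bmeas2M; [exact: bmeas2_comp bw cg|exact: bmeas2_snd].
    move=> k a c a0 ac.
    rewrite -(@flux_integral u w g _ b)//; last exact: bmeas_hump.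
    apply: (H (fun p => hump k a c p.1 * b p.2)).
      apply: (@tensor_test_function _ _ a c (ratr p) (ratr s)) => //.
        by move=> j; exact: Ck_hump.
      move=> t; rewrite negb_and -!ltNge => tac; apply: hump_eq0.
      by rewrite negb_and -!leNgt; case/orP: tac => /ltW ->; rewrite ?orbT.
    by move=> z; rewrite mulr_ge0 ?hump_ge0.
  by apply: ae_imp.
apply: ae_imp => t Ht t0 p q r s p0 pq qr rs s1.
apply: avg_le_from_trapezoids => //.
  exact: bmeas2_slice1 (bmeas2_comp bw cg).
by move=> n; exact: (Ht (n, (p, q, r, s))).
Qed.

End reduction.

(** * The quadratic boundary entropy *)

Section quadratic_entropy.
Context {R : realType}.
Implicit Types (J K : R -> R).

(* Boundary entropy flux of [(v - w)^2] at [p = (v, w)], for [K' = J]. *)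
Definition qflux J K (p : R * R) : R :=
  2 * (J p.1 * (p.1 - p.2)) - 2 * K p.1 + 2 * K p.2.

Lemma derive1_funE (f f' : R -> R) : (forall x : R, is_derive x 1 f (f' x)) ->
  f^`()%classic = f'.
Proof. by move=> H; apply/funext => x; rewrite derive1E; have [_ ->] := H x. Qed.

Lemma is_derive_qflux J K w (v : R) : Ck 2 J -> (forall x : R, is_derive x 1 K (J x)) ->
  is_derive v 1 (fun v => qflux J K (v, w)) (J^`()%classic v * (2 * (v - w))).
Proof.
move=> J2 KJ; have dJ := Ck_is_derive v J2.
have dv := is_deriveB (is_derive_id v 1) (is_derive_cst w v 1).
have d := is_deriveD (is_deriveB (is_deriveZ 2 (is_deriveM dJ dv))
  (is_deriveZ 2 (KJ v))) (is_derive_cst (2 * K w) v 1).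
apply: (is_derive_eq d); rewrite /GRing.scale/= !fctE; ring.
Qed.

Lemma lax_affine J (c : R) : Ck 2 J -> lax_pair J (fun v => c * v) (fun v => c * J v).
Proof.
move=> J2; have dS (x : R) : is_derive x 1 (fun v : R => c * v) c.
  by apply: (is_derive_eq (is_deriveZ c (is_derive_id x 1))); rewrite /GRing.scale/= mulr1.
have S1 : (fun v : R => c * v)^`()%classic = cst c by exact: derive1_funE.
split.
- by apply: CkZ; exact: Ck_id.
- exact: CkZ.
- by move=> v; rewrite /derive1n/= S1 derive1_cst.
- move=> v; have dQ (x : R) := is_deriveZ c (Ck_is_derive x J2).
  by rewrite S1 (derive1_funE dQ) mulrC.
Qed.

Lemma lax_quadratic J K (w : R) : Ck 2 J -> (forall x : R, is_derive x 1 K (J x)) ->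
  lax_pair J (fun v => (v - w) ^+ 2) (fun v => qflux J K (v, w)).
Proof.
move=> J2 KJ; have d (x : R) : is_derive x 1 (fun v : R => v - w) 1.
  by apply: (is_derive_eq (is_deriveB (is_derive_id x 1) (is_derive_cst w x 1)));
    rewrite subr0.
have dS (x : R) : is_derive x 1 (fun v : R => (v - w) ^+ 2) (2 * (x - w)).
  by apply: (is_derive_eq (is_deriveM (d x) (d x))); rewrite /GRing.scale/=; ring.
have S1 := derive1_funE dS.
have K2 : Ck 2 K by apply: (Ck_SI KJ); exact: CkS.
split.
- have Cd : Ck 2 (fun v : R => v - w).
    by apply: (@CkB _ _ 2 idfun (cst w)); [exact: Ck_id|exact: Ck_cst].
  by apply: (@Ck_ext _ _ 2 _ _ _ (CkM Cd Cd)) => v; rewrite expr2.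
- have Cd : Ck 2 (fun v : R => v - w).
    by apply: (@CkB _ _ 2 idfun (cst w)); [exact: Ck_id|exact: Ck_cst].
  have C := CkD (CkB (CkZ 2 (CkM J2 Cd)) (CkZ 2 K2)) (@Ck_cst R R 2 (2 * K w)).
  by apply: Ck_ext C => v; rewrite /qflux !fctE.
- have d2 (x : R) : is_derive x 1 (fun v : R => 2 * (v - w)) 2.
    by apply: (is_derive_eq (is_deriveZ 2 (d x))); rewrite /GRing.scale/= mulr1.
  by move=> v; rewrite /derive1n/= S1 (derive1_funE d2) ler0n.
- by move=> v; rewrite S1 (derive1_funE (fun x => is_derive_qflux w x J2 KJ)).
Qed.

Lemma boundary_quadratic J K : Ck 2 J -> (forall x : R, is_derive x 1 K (J x)) ->
  boundary_flux J (qflux J K).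
Proof.
move=> J2 KJ; exists (fun p => (p.1 - p.2) ^+ 2).
have K2 : Ck 2 K by apply: (Ck_SI KJ); exact: CkS.
have Cd : Ck 2 (fun p : R * R => p.1 - p.2).
  exact: CkB (Ck_fst (Ck_id 2)) (Ck_snd (Ck_id 2)).
split.
- by apply: (@Ck_ext _ _ 2 _ _ _ (CkM Cd Cd)) => p; rewrite expr2.
- have C := CkD (CkB (CkZ 2 (CkM (Ck_fst J2) Cd)) (CkZ 2 (Ck_fst K2)))
    (CkZ 2 (Ck_snd K2)).
  by apply: Ck_ext C => p; rewrite /qflux !fctE.
- by move=> w; exact: lax_quadratic.
- move=> w; split; rewrite /qflux/= ?subrr ?expr0n//=; first by ring.
  rewrite (_ : (fun v : R => _) = (fun v => v - w) * (fun v => v - w))//.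
  have d : is_derive w 1 (fun v : R => v - w) 1.
    by apply: (is_derive_eq (is_deriveB (is_derive_id w 1) (is_derive_cst w w 1)));
      rewrite subr0.
  rewrite derive1E; have [_ ->] := is_deriveM d d.
  by rewrite subrr !scale0r addr0.
Qed.

(** This says that the integral of J - c over []a, b[] is positive. It governs every sign of
    [qflux], because [qflux J K (v, w)] is twice the integral of J(s) - J(v) for s from v to w. *)
Lemma antiderivative_drop J K (c a b : R) : (forall x : R, is_derive x 1 K (J x)) ->
  a < b -> (forall s, a < s < b -> c < J s) -> c * b - K b < c * a - K a.
Proof.
move=> KJ ab cJ; have [s sab E] := mean_value KJ ab.
have : 0 < (J s - c) * (b - a) by rewrite mulr_gt0// subr_gt0// cJ.
rewrite mulrBl -E; lra.
Qed.

Section concave.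
Context (J K : R -> R) (m : R).
Context (J_C2 : Ck 2 J) (J_concave : forall v, J^`(2)%classic v < 0).
Context (m_unique_max : forall v, v != m -> J v < J m).

Let dJ (x : R) : is_derive x 1 J (J^`()%classic x).
Proof. exact: Ck_is_derive J_C2. Qed.

Let dJ_decr (a b : R) : a < b -> J^`()%classic b < J^`()%classic a.
Proof.
move=> ab; have d2 (x : R) : is_derive x 1 J^`()%classic (J^`(2)%classic x).
  exact: Ck_is_derive (Ck_derive1 J_C2).
have [c _ E] := mean_value d2 ab.
by rewrite -subr_lt0 E pmulr_llt0 ?subr_gt0.
Qed.

(** Otherwise J' is nonpositive at some c between a and b, hence also after c since J' decreases.
    Then [J m <= J b <= J a], against the uniqueness of the maximum. *)
Lemma concave_increasing (a b : R) : a < b -> b <= m -> J a < J b.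
Proof.
move=> ab bm; rewrite ltNge; apply/negP => Jba.
have [c /andP[ac cb] E] := mean_value dJ ab.
have Jc : J^`()%classic c <= 0.
  have : J^`()%classic c * (b - a) <= 0 by rewrite -E subr_le0.
  by rewrite pmulr_lle0 ?subr_gt0.
have Jbm : J m <= J b.
  move: bm; rewrite le_eqVlt => /predU1P[->//|bm].
  have [e /andP[be em] E'] := mean_value dJ bm.
  have := dJ_decr (lt_trans cb be) => ec.
  rewrite -subr_le0 E' pmulr_lle0 ?subr_gt0//.
  by apply: le_trans (ltW ec) Jc.
have am : a != m by rewrite lt_eqF// (lt_le_trans ab).
by have := m_unique_max am; rewrite ltNge (le_trans Jbm).
Qed.

Lemma concave_decreasing (a b : R) : m <= a -> a < b -> J b < J a.
Proof.
move=> ma ab; rewrite ltNge; apply/negP => Jab.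
have [c /andP[ac cb] E] := mean_value dJ ab.
have Jc : 0 <= J^`()%classic c.
  have : 0 <= J^`()%classic c * (b - a) by rewrite -E subr_ge0.
  by rewrite pmulr_lge0 ?subr_gt0.
have Jma : J m <= J a.
  move: ma; rewrite le_eqVlt => /predU1P[->//|ma].
  have [e /andP[me ea] E'] := mean_value dJ ma.
  have ec := dJ_decr (lt_trans ea ac).
  rewrite -subr_ge0 E' pmulr_lge0 ?subr_gt0//.
  exact: le_trans Jc (ltW ec).
have bm : b != m by rewrite gt_eqF// (le_lt_trans ma).
by have := m_unique_max bm; rewrite ltNge (le_trans Jma).
Qed.

Lemma concave_level (a b : R) : a < b -> J a = J b ->
  a < m < b /\ forall s, a < s < b -> J a < J s.
Proof.
move=> ab Jab.
have am : a < m.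
  by rewrite ltNge; apply/negP => ma; have := concave_decreasing ma ab; rewrite Jab ltxx.
have mb : m < b.
  by rewrite ltNge; apply/negP => bm; have := concave_increasing ab bm; rewrite Jab ltxx.
split=> [|s /andP[as_ sb]]; first by rewrite am.
have [sm|ms] := leP s m; first exact: concave_increasing.
by rewrite Jab; apply: concave_decreasing => //; exact: ltW.
Qed.

Lemma concave_le_max v : J v <= J m.
Proof. by have [->//|/m_unique_max/ltW] := eqVneq v m. Qed.

Context (KJ : forall x : R, is_derive x 1 K (J x)).

(** The difference of the two fluxes is twice the integral of J - J(a) over []a, b[], positive
    because J exceeds its common end value inside. This is what forbids a downward jump. *)
Lemma qflux_drop (a b w : R) : a < b -> J a = J b -> qflux J K (b, w) < qflux J K (a, w).
Proof.
move=> ab Jab; have [_ lev] := concave_level ab Jab.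
have := antiderivative_drop KJ ab lev; rewrite /qflux /= -Jab; lra.
Qed.

Context (J0 : J 0 = 0) (J1 : J 1 = 0) (m01 : 0 < m < 1).

(** If v < 0, then J(v) < 0 is below J on all of []v, w[]: J increases up to m, and between m and 1
    it is above [J 1], which is 0. The integral form of the flux is then positive. *)
Lemma qflux_le0 (v w : R) : 0 <= w <= 1 -> qflux J K (v, w) <= 0 -> 0 <= v.
Proof.
move=> /andP[w0 w1]; rewrite leNgt => Q0; rewrite leNgt; apply/negP => v0; move: Q0.
have /andP[m0 m1] := m01.
have Jv : J v < 0 by rewrite -J0; apply: concave_increasing => //; exact: ltW.
have vw : v < w by exact: lt_le_trans v0 w0.
have H s : v < s < w -> J v < J s.
  move=> /andP[vs sw]; have [sm|ms] := leP s m; first exact: concave_increasing.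
  apply: (lt_trans Jv); rewrite -J1; apply: concave_decreasing; first exact: ltW.
  exact: lt_le_trans sw w1.
by have := antiderivative_drop KJ vw H; rewrite /qflux /=; lra.
Qed.

(** If v > 1, J is again above J(v) on []w, v[], but the integral from v to w now runs backwards, so
    the flux is negative. *)
Lemma qflux_ge0 (v w : R) : 0 <= w <= 1 -> 0 <= qflux J K (v, w) -> v <= 1.
Proof.
move=> /andP[w0 w1]; rewrite leNgt => Q0; rewrite leNgt; apply/negP => v1; move: Q0.
have /andP[m0 m1] := m01.
have Jv : J v < 0 by rewrite -J1; apply: concave_decreasing => //; exact: ltW.
have wv : w < v by exact: le_lt_trans w1 v1.
have H s : w < s < v -> J v < J s.
  move=> /andP[ws sv]; have [sm|ms] := leP s m; last first.
    by apply: concave_decreasing => //; exact: ltW.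
  apply: (lt_trans Jv); rewrite -J0; apply: concave_increasing => //.
  exact: le_lt_trans w0 ws.
by have := antiderivative_drop KJ wv H; rewrite /qflux /=; lra.
Qed.

Lemma concave_ge0 v : 0 <= v -> v <= 1 -> 0 <= J v.
Proof.
move=> v0 v1; have [vm|mv] := leP v m.
  move: v0; rewrite le_eqVlt => /predU1P[<-|v0]; first by rewrite J0.
  by rewrite -[leLHS]J0; apply: ltW; exact: concave_increasing.
move: v1; rewrite le_eqVlt => /predU1P[->|v1]; first by rewrite J1.
by rewrite -[leLHS]J1; apply: ltW; apply: concave_decreasing => //; exact: ltW.
Qed.

Lemma level_branches c : 0 <= c <= J m -> exists z : R * R,
  [/\ 0 <= z.1 <= m, m <= z.2 <= 1, J z.1 = c & J z.2 = c].
Proof.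
move=> /andP[c0 cm]; have /andP[m0 m1] := m01.
have cJ : continuous J by exact: Ck_continuous J_C2.
have [|a + aE] := @IVT R J 0 m c (ltW m0) (continuous_subspaceT cJ).
  by rewrite J0 min_l ?max_r ?c0// (le_trans c0).
have [|b + bE] := @IVT R J m 1 c (ltW m1) (continuous_subspaceT cJ).
  by rewrite J1 min_r ?max_l ?c0// (le_trans c0).
by rewrite !in_itv/= => mb1 ma0; exists (a, b).
Qed.

Lemma level_set v a b : a <= m -> m <= b -> J v = J a -> J v = J b -> v = a \/ v = b.
Proof.
move=> am mb va vb; have [vm|mv] := leP v m; [left|right].
  have [va'|av|//] := ltgtP v a.
    by have := concave_increasing va' am; rewrite va ltxx.
  by have := concave_increasing av vm; rewrite va ltxx.
have [vb'|bv|//] := ltgtP v b.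
  by have := concave_decreasing (ltW mv) vb'; rewrite vb ltxx.
by have := concave_decreasing mb bv; rewrite vb ltxx.
Qed.

End concave.
End quadratic_entropy.

(** * Boundary traces *)

Section traces.
Context {R : realType}.
Notation mu := (leb R).

Lemma C1_Rplus_continuous (f : R -> R) : C1_Rplus f -> {within `[0, +oo[, continuous f}.
Proof.
move=> [df _ H]; apply/subspace_continuousP => t; rewrite /= in_itv/= andbT => t0.
apply/cvgrPdist_le => e e0.
have /cvgrPdist_le/(_ 1 ltr01) := H t t0; rewrite near_withinE => Ht.
(* Near t the difference quotient is within 1 of [df t], so [C] is a Lipschitz constant at t. *)
pose C := `|df t| + 1.
have C0 : 0 < C by rewrite ltr_wpDl.
have Hd : \forall s \near t, `|t - s| < e / C.
  by have := @nbhsx_ballx R R t (e / C) (divr_gt0 e0 C0); apply: filterS.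
near=> s => s0; rewrite /= in_itv/= andbT in s0.
have [->|st] := eqVneq s t; first by rewrite subrr normr0 ltW.
have st0 : s - t != 0 by rewrite subr_eq0.
have qC : `|(f s - f t) / (s - t)| <= C.
  have Hs : 0 <= s /\ s != t -> `|df t - (f s - f t) / (s - t)| <= 1 by near: s.
  have := Hs (conj s0 st).
  by rewrite /C distrC => h; have := ler_normD ((f s - f t) / (s - t) - df t) (df t);
    rewrite subrK => /le_trans; apply; rewrite addrC lerD2l.
rewrite distrC -[f s - f t](divfK st0) normrM distrC.
have ts : `|t - s| < e / C by near: s.
by apply: le_trans (ler_pM _ _ qC (ltW ts)) _ => //; rewrite mulrCA divff ?mulr1// gt_eqF.
Unshelve. all: by end_near. Qed.

(** The values of [f] at negative times are arbitrary, hence the extension by zero. *)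
Lemma bmeas_C1_Rplus (f : R -> R) : C1_Rplus f -> (forall t, 0 <= t -> 0 <= f t <= 1) ->
  bmeas (f \_ `[0, +oo[).
Proof.
move=> Cf f01; split.
  apply/(measurable_restrictT _ _).1 => //.
  by apply: subspace_continuous_measurable_fun => //; exact: C1_Rplus_continuous.
exists 1 => t; rewrite patchE; case: ifPn => [|_]; last by rewrite normr0.
by rewrite inE/= in_itv/= andbT => /f01/andP[f0 f1]; rewrite ger0_norm.
Qed.

Lemma bmeas_min (f g : R -> R) : bmeas f -> bmeas g -> bmeas (fun x => Num.min (f x) (g x)).
Proof.
move=> [mf [M fM]] [mg [N gN]]; split; first exact: measurable_minr.
exists (M + N) => x; rewrite /Num.min; case: ifP => _.
  by apply: le_trans (fM x) _; rewrite lerDl (le_trans _ (gN x)).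
by apply: le_trans (gN x) _; rewrite lerDr (le_trans _ (fM x)).
Qed.

(** The minimum of [f] and [g] equals [f] almost everywhere on the interval and lies below [g]
    everywhere, which reduces the claim to a pointwise comparison. *)
Lemma ae_le_Rintegral (f g : R -> R) (b1 b2 : bool) (p q : R) : bmeas f -> bmeas g ->
  {ae mu, forall x, [set` Interval (BSide b1 p) (BSide b2 q)] x -> f x <= g x} ->
  \int[mu]_(x in [set` Interval (BSide b1 p) (BSide b2 q)]) f x <=
  \int[mu]_(x in [set` Interval (BSide b1 p) (BSide b2 q)]) g x.
Proof.
move=> bf bg fg; have bm := bmeas_min bf bg.
rewrite (@ae_Rintegral_eq _ _ f (fun x => Num.min (f x) (g x)))//.
- apply: le_Rintegral => //; [exact: bmeas_integrable_itv..|].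
  by move=> x _; rewrite ge_min lexx orbT.
- exact: measurable_funS bf.1.
- exact: measurable_funS bm.1.
- by apply: ae_imp fg => x fgx /fgx fgx'; rewrite min_l.
Qed.

Lemma avg_bmeas (G : R * R -> R) p q : bmeas2 G -> bmeas (fun t => avg (fun x => G (t, x)) p q).
Proof.
move=> bG; apply: bmeasM; last exact: bmeas_cst.
exact: (bmeas_Rintegral_snd false true p q bG).
Qed.

Lemma Rintegral_hump_support k a c (f : R -> R) : 0 < a ->
  \int[mu]_(t in `[0, +oo[) (hump k a c t * f t) = \int[mu]_(t in `[a, c]) (hump k a c t * f t).
Proof.
move=> a0; apply: Rintegral_support.
  by move=> x /=; rewrite !in_itv/= andbT => /andP[/(le_trans (ltW a0))].
move=> x _ xac; rewrite hump_eq0 ?mul0r//; apply/negP => /andP[ax xc].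
by apply: xac; rewrite /= in_itv/= !ltW.
Qed.

(** Fubini on the rectangle to which the hump confines the integral: the time integral of an average
    becomes an average in x of the time integrals that the boundary conditions control. *)
Lemma Rintegral_hump_avg (G : R * R -> R) k a c p q : bmeas2 G -> 0 < a ->
  \int[mu]_(t in `[0, +oo[) (hump k a c t * avg (fun x => G (t, x)) p q) =
  (\int[mu]_(x in `]p, q[) \int[mu]_(t in `[0, +oo[) (hump k a c t * G (t, x))) / (q - p).
Proof.
move=> bG a0; rewrite Rintegral_hump_support//.
under [in RHS]eq_Rintegral do rewrite Rintegral_hump_support//.
have bhG : bmeas2 (fun z => hump k a c z.1 * G z).
  by apply: bmeas2M => //; apply: bmeas2_fst; exact: bmeas_hump.
rewrite -(Rintegral_swap a c p q true false false true bhG).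
rewrite -RintegralZr//; last first.
  exact/bmeas_integrable_itv/(bmeas_Rintegral_snd false true p q bhG).
apply: eq_Rintegral => t _; rewrite /avg /= RintegralZl ?mulrA//.
exact/bmeas_integrable_itv/bmeas2_slice1.
Qed.

(* [(p', q')] is meant to lie close to the boundary point at which the trace of [G] is
   known to be nonpositive. *)
Lemma nonpositive_from_trace (G : R * R -> R) : bmeas2 G ->
  (forall (p q : rat) k (a c e : R), 0 < (ratr p : R) -> (ratr p : R) < ratr q ->
    (ratr q : R) < 1 -> 0 < a -> a < c -> 0 < e ->
    exists p' q' : R, [/\ p' < q',
      {ae mu, forall t, 0 <= t -> avg (fun x => G (t, x)) (ratr p) (ratr q)
                              <= avg (fun x => G (t, x)) p' q'} &
      {ae mu, forall x, p' < x < q' ->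
         \int[mu]_(t in `[0, +oo[) (hump k a c t * G (t, x)) <= e}]) ->
  {ae mu, forall t, 0 <= t -> {ae mu, forall x, 0 < x < 1 -> G (t, x) <= 0}}.
Proof.
move=> bG H.
have : {ae mu, forall t, forall pq : rat * rat,
    0 < (ratr pq.1 : R) -> (ratr pq.1 : R) < ratr pq.2 -> (ratr pq.2 : R) < 1 -> 0 <= t ->
    avg (fun x => G (t, x)) (ratr pq.1) (ratr pq.2) <= 0}.
  apply: ae_forall_countable => -[p q] /=.
  have [p0|] := boolP (0 < (ratr p : R)); last by move=> _; exact: aeW.
  have [pq|] := boolP ((ratr p : R) < ratr q); last by move=> _; exact: aeW.
  have [q1|] := boolP ((ratr q : R) < 1); last by move=> _; exact: aeW.
  have bA := avg_bmeas (ratr p) (ratr q) bG.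
  suff : {ae mu, forall t, 0 <= t -> 0 <= - avg (fun x => G (t, x)) (ratr p) (ratr q)}.
    by apply: ae_imp => t + _ _ _ t0 => /(_ t0); rewrite oppr_ge0.
  apply: ae_ge0_from_humps; first exact: bmeasN.
  move=> k a c a0 ac.
  have bhA p' q' : bmeas (fun t => hump k a c t * avg (fun x => G (t, x)) p' q').
    by apply: bmeasM; [exact: bmeas_hump|exact: avg_bmeas].
  under eq_Rintegral do rewrite mulrN -mulrN1 -mulrA.
  rewrite Rintegral_hump_support//; under eq_Rintegral do rewrite mulrA.
  rewrite RintegralZr//; last exact: bmeas_integrable_itv.
  rewrite mulrN1 oppr_ge0 leNgt; apply/negP => I0.
  set I := (X in 0 < X) in I0.
  (* The tolerance is half of the supposedly positive integral, so the comparison near the boundary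
     gives the absurd [I <= I / 2]. *)
  have I2 : 0 < I / 2 by rewrite divr_gt0.
  have [p' [q' [pq' pq'G pq'e]]] := H p q k a c _ p0 pq q1 a0 ac I2.
  suff : I <= I / 2 by lra.
  apply: (@le_trans _ _ (\int[mu]_(t in `[0, +oo[)
      (hump k a c t * avg (fun x => G (t, x)) p' q'))).
    rewrite [leRHS]Rintegral_hump_support//; apply: ae_le_Rintegral => //.
    apply: ae_imp pq'G => t tG; rewrite /= in_itv/= => /andP[at_ _].
    by rewrite ler_wpM2l ?hump_ge0// tG// (le_trans (ltW a0)).
  rewrite Rintegral_hump_avg// ler_pdivrMr ?subr_gt0//.
  rewrite -(Rintegral_itv_cst (I / 2) pq').
  have bhG : bmeas2 (fun z => hump k a c z.2 * G (z.2, z.1)).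
    by apply: bmeas2M; [apply: bmeas2_snd; exact: bmeas_hump|exact: bmeas2_swap].
  under eq_Rintegral do rewrite Rintegral_hump_support//.
  apply: (@ae_le_Rintegral _ (cst (I / 2))).
  - exact: (bmeas_Rintegral_snd true false a c bhG).
  - exact: bmeas_cst.
  apply: ae_imp pq'e => x xe; rewrite /= in_itv/= => /xe.
  by rewrite Rintegral_hump_support.
apply: ae_imp => t Ht t0.
have : {ae mu, forall x, `]0, 1[%classic x -> G (t, x) <= 0}.
  apply: ae_le0_from_rational => //; first exact: bmeas2_slice1.
  move=> p q pq pq01.
  have p0 : 0 < (ratr p : R).
    by have /= := pq01 (ratr p); rewrite !in_itv/= lexx (ltW pq)/= => /(_ isT)/andP[].
  have q1 : (ratr q : R) < 1.
    by have /= := pq01 (ratr q); rewrite !in_itv/= lexx (ltW pq)/= => /(_ isT)/andP[].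
  have := Ht (p, q) p0 pq q1 t0.
  by rewrite avgE /= pmulr_lle0// invr_gt0 subr_gt0.
by apply: ae_imp => x; rewrite /= in_itv.
Qed.

Lemma avgN (f : R -> R) (p q : R) : bmeas f -> avg (fun x => - f x) p q = - avg f p q.
Proof.
move=> bf; rewrite !avgE; under eq_Rintegral do rewrite -mulN1r.
by rewrite RintegralZl//; [rewrite mulN1r mulNr|exact: bmeas_integrable_itv].
Qed.

Definition ordered_averages (G : R * R -> R) := {ae mu, forall t, 0 <= t ->
  forall p q r s : rat, 0 < (ratr p : R) ->
    (ratr p : R) < ratr q -> (ratr q : R) <= ratr r -> (ratr r : R) < ratr s ->
    (ratr s : R) < 1 ->
    avg (fun x => G (t, x)) (ratr r) (ratr s) <= avg (fun x => G (t, x)) (ratr p) (ratr q)}.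

(** Averages decrease to the right, so the average over []p, q[] is dominated by one over an
    interval squeezed between 0 and the minimum of [d] and p, where the trace bound applies. *)
Lemma trace_left (G : R * R -> R) : bmeas2 G -> ordered_averages G ->
  (forall k (a c e : R), 0 < a -> a < c -> 0 < e -> exists2 d, 0 < d &
     {ae mu, forall x, 0 < x < d ->
        \int[mu]_(t in `[0, +oo[) (hump k a c t * G (t, x)) <= e}) ->
  {ae mu, forall t, 0 <= t -> {ae mu, forall x, 0 < x < 1 -> G (t, x) <= 0}}.
Proof.
move=> bG oG H; apply: nonpositive_from_trace => // p q k a c e p0 pq q1 a0 ac e0.
have [d d0 Hd] := H k a c e a0 ac e0.
have [|q'] := @rat_in_itvoo R 0 (Num.min d (ratr p)); first by rewrite lt_min d0.
rewrite in_itv/= lt_min => /andP[q'0 /andP[q'd q'p]].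
have [p'] := @rat_in_itvoo R 0 (ratr q') q'0.
rewrite in_itv/= => /andP[p'0 p'q'].
exists (ratr p'), (ratr q'); split => //.
  by apply: ae_imp oG => t + t0 => /(_ t0); apply => //; exact: ltW.
apply: ae_imp Hd => x + /andP[p'x xq'].
by apply; rewrite (lt_trans p'0 p'x) (lt_trans xq').
Qed.

(** The averages of [- G] increase to the right, so for [- G] the dominating interval is squeezed
    against 1. *)
Lemma trace_right (G : R * R -> R) : bmeas2 G -> ordered_averages G ->
  (forall k (a c e : R), 0 < a -> a < c -> 0 < e -> exists2 d, 0 < d &
     {ae mu, forall x, 1 - d < x < 1 ->
        - e <= \int[mu]_(t in `[0, +oo[) (hump k a c t * G (t, x))}) ->
  {ae mu, forall t, 0 <= t -> {ae mu, forall x, 0 < x < 1 -> 0 <= G (t, x)}}.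
Proof.
move=> bG oG H.
have bNG : bmeas2 (fun z => - G z).
  by have [mG [M GM]] := bG; split; [exact: measurableT_comp|exists M => z; rewrite normrN].
suff : {ae mu, forall t, 0 <= t -> {ae mu, forall x, 0 < x < 1 -> - G (t, x) <= 0}}.
  apply: ae_imp => t + t0 => /(_ t0); apply: ae_imp => x + x01 => /(_ x01).
  by rewrite oppr_le0.
apply: (nonpositive_from_trace bNG) => p q k a c e p0 pq q1 a0 ac e0.
have [d d0 Hd] := H k a c e a0 ac e0.
have [|p'] := @rat_in_itvoo R (Num.max (1 - d) (ratr q)) 1.
  by rewrite gt_max q1 andbT ltrBlDr ltrDl.
rewrite in_itv/= gt_max => /andP[/andP[dp' qp'] p'1].
have [q'] := @rat_in_itvoo R (ratr p') 1 p'1.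
rewrite in_itv/= => /andP[p'q' q'1].
exists (ratr p'), (ratr q'); split => //.
  apply: ae_imp oG => t + t0 => /(_ t0 p q p' q' p0 pq (ltW qp') p'q' q'1).
  by rewrite !avgN ?lerN2//; exact: bmeas2_slice1.
apply: ae_imp Hd => x + /andP[p'x xq'].
have -> : 1 - d < x < 1 by rewrite (lt_trans dp' p'x) (lt_trans xq').
move=> /(_ isT); rewrite lerNl.
under [in X in _ -> X]eq_Rintegral do rewrite mulrN -mulN1r.
have bhG : bmeas (fun t => hump k a c t * G (t, x)).
  by apply: bmeasM; [exact: bmeas_hump|exact: bmeas2_slice2].
rewrite Rintegral_hump_support//.
rewrite [X in _ -> X <= _](@Rintegral_support _ _ `[a, c]).
- rewrite RintegralZl// ?mulN1r//; exact: bmeas_integrable_itv.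
- by move=> y /=; rewrite !in_itv/= andbT => /andP[/(le_trans (ltW a0))].
- move=> y _ yac; rewrite hump_eq0 ?mul0r ?mulr0//; apply/negP => /andP[ax xc].
  by apply: yac; rewrite /= in_itv/= !ltW.
Qed.

Lemma ess_lim0_near (F : R -> R) l e : ess_lim0 F l -> 0 < e ->
  exists2 d, 0 < d & {ae mu, forall r, 0 < r < d -> `|l - F r| <= e}.
Proof.
move=> [N [A [mA A0 NA]] /cvgrPdist_le/(_ e) + e0] => /(_ e0).
rewrite !near_withinE => /nbhs_ballP[d /= d0 Hd]; exists d => //.
exists A; split => // r /= rF; apply: NA; apply: contrapT => Nr; apply: rF.
move=> /andP[r0 rd]; apply: Hd => //.
by rewrite /ball/= sub0r normrN gtr0_norm.
Qed.

(** The same two-stage replacement as in [flux_integral], now with x fixed: the exceptional x come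
    from the sections of the null set in the other direction. *)
Lemma boundary_integral u w J K (rho : R -> R) k (a c : R) :
  measurable_fun setT (u \_ (@space_time R)) -> bmeas2 w ->
  {ae leb2 R, forall p, space_time p -> u p = w p} ->
  continuous J -> continuous K -> bmeas (rho \_ `[0, +oo[) ->
  {ae mu, forall x, 0 < x < 1 ->
    \int[mu]_(t in `[0, +oo[) (qflux J K (u (t, x), rho t) * hump k a c t) =
    \int[mu]_(t in `[0, +oo[) (hump k a c t *
       qflux J K (w (t, x), (rho \_ `[0, +oo[) t))}.
Proof.
set v := u \_ _ => mv bw uw cJ cK brho; set rho0 := rho \_ _.
have mJ : measurable_fun setT J by exact: continuous_measurable_fun.
have mK : measurable_fun setT K by exact: continuous_measurable_fun.
have mq (f g : R -> R) : measurable_fun setT f -> measurable_fun setT g ->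
    measurable_fun setT (fun t => qflux J K (f t, g t)).
  move=> mf mg; apply: measurable_funD; last first.
    by apply: measurable_funM => //; exact: measurableT_comp.
  apply: measurable_funB; last by apply: measurable_funM => //; exact: measurableT_comp.
  apply: measurable_funM => //; apply: measurable_funM; first exact: measurableT_comp.
  exact: measurable_funB.
apply: ae_imp (ae_prod2 uw) => x uwx /andP[x0 x1].
have st t : 0 <= t -> space_time (t, x).
  by move=> t0; split; rewrite /= in_itv/= ?t0// !ltW.
transitivity (\int[mu]_(t in `[0, +oo[)
    (hump k a c t * qflux J K (v (t, x), rho0 t))).
  apply: eq_Rintegral => t t0; rewrite mulrC /rho0 [in RHS]patchE t0.
  by rewrite /v patchE mem_set//; apply: st; move: t0; rewrite inE/= in_itv/= andbT.
have mh : measurable_fun setT (hump k a c) by case: (bmeas_hump k a c).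
have mrho := brho.1.
apply: ae_Rintegral_eq => //.
- apply: (@measurable_funS _ _ _ _ setT) => //; apply: measurable_funM => //.
  by apply: mq => //; exact: measurable_fun_pair1.
- apply: (@measurable_funS _ _ _ _ setT) => //; apply: measurable_funM => //.
  by apply: mq => //; exact: measurable_fun_pair1 bw.1.
- apply: ae_imp uwx => t uwt; rewrite /= in_itv/= andbT => t0.
  by rewrite -uwt ?/v ?patchE ?mem_set//; exact: st.
Qed.

End traces.

(** * Shape of a time slice, and ordered averages of the boundary flux *)

Section assembly.
Context {R : realType}.
Notation mu := (leb R).

Lemma avgD (f g : R -> R) (p q : R) : bmeas f -> bmeas g ->
  avg (fun x => f x + g x) p q = avg f p q + avg g p q.
Proof. by move=> bf bg; rewrite !avgE RintegralD ?mulrDl//; exact: bmeas_integrable_itv. Qed.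

Lemma avgZ (c : R) (f : R -> R) (p q : R) : bmeas f ->
  avg (fun x => c * f x) p q = c * avg f p q.
Proof. by move=> bf; rewrite !avgE RintegralZl ?mulrA//; exact: bmeas_integrable_itv. Qed.

Lemma avg_cst (c p q : R) : p < q -> avg (fun=> c) p q = c.
Proof. by move=> pq; rewrite avgE Rintegral_itv_cst// mulfK// subr_eq0 gt_eqF. Qed.

Lemma ae_neq (c : R) : {ae mu, forall t : R, t <> c}.
Proof.
exists [set c]; split => //; first exact: lebesgue_measure_set1.
by move=> t /=; apply: contrapT.
Qed.

Lemma ae_ex (P : R -> Prop) : {ae mu, forall x, P x} -> exists2 x, 0 < x < 1 & P x.
Proof.
move=> [A [mA A0 PA]]; apply: contrapT => H.
have sub : `]0, 1[%classic `<=` A.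
  by move=> x; rewrite /= in_itv/= => x01; apply: PA => /= Px; apply: H; exists x.
have : (mu (`]0%R, 1%R[%classic : set R) <= mu A)%E by apply: le_measure => //; rewrite inE.
by rewrite lebesgue_measure_itv/= lte_fin ltr01 [X in (_ <= X)%E]A0 sube0 lee_fin ler10.
Qed.

(** The jump point is the supremum of the good points where [f] differs from [b]. To its left [f]
    cannot be [b], since that value would persist up to a later such point. If there are none, or if
    the supremum is at least 1, [f] is constant. *)
Lemma two_valued_step (f : R -> R) (P : R -> Prop) (a b : R) :
  {ae mu, forall x, P x} -> (forall x, P x -> 0 < x < 1 -> f x = a \/ f x = b) ->
  (forall x y, P x -> P y -> 0 < x -> x < y -> y < 1 -> f x = b -> f y = b) ->
  (exists c, {ae mu, forall x, 0 < x < 1 -> f x = c}) \/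
  (exists2 X, 0 < X < 1 & {ae mu, forall x, 0 < x < 1 ->
     (x < X -> f x = a) /\ (X < x -> f x = b)}).
Proof.
move=> aP fab fb; pose E := [set x | [/\ P x, 0 < x < 1 & f x <> b]].
have [E0|/set0P[x0 Ex0]] := eqVneq E set0.
  left; exists b; apply: ae_imp aP => x Px x01; apply: contrapT => fxb.
  by have : E x by []; rewrite E0.
have supE : has_sup E.
  by split; [exists x0|exists 1 => x [_ /andP[_ /ltW]]].
have below x : P x -> 0 < x < 1 -> x < sup E -> f x = a.
  move=> Px x01 xE; have [//|fxb] := fab x Px x01.
  have e0 : 0 < sup E - x by rewrite subr_gt0.
  have [y [Py /andP[y0 y1] fyb]] := sup_adherent e0 supE; rewrite opprB addrC subrK => xy.
  by exfalso; apply: fyb; apply: (fb x) => //; have /andP[] := x01.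
have above x : P x -> 0 < x < 1 -> sup E < x -> f x = b.
  move=> Px x01 Ex; apply: contrapT => fxb; move: Ex; rewrite ltNge => /negP; apply.
  by apply: ub_le_sup => //; case: supE.
have E_gt0 : 0 < sup E.
  have [_ /andP[x00 _] _] := Ex0; apply: lt_le_trans x00 _.
  by apply: ub_le_sup => //; case: supE.
have [E1|E1] := ltP (sup E) 1.
  right; exists (sup E); first by rewrite E_gt0.
  by apply: ae_imp aP => x Px x01; split=> ?; [exact: below|exact: above].
left; exists a; apply: ae_imp aP => x Px x01; apply: below => //.
by apply: lt_le_trans E1; have /andP[] := x01.
Qed.

Lemma step_bounded_variation (a b X : R) : a <= b ->
  bounded_variation 0 1 (fun x => if x < X then a else b).
Proof.
move=> ab; apply: nondecreasing_bounded_variation => x y _ _ xy.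
case: ifPn => xX; case: ifPn => // yX.
by move: xX; rewrite (le_lt_trans xy yX).
Qed.

Lemma tsupport_hump k (a c : R) : tsupport (hump k a c) `<=` `[a, c].
Proof.
rewrite /tsupport closureE; apply: smallest_sub; first exact: interval_closed.
move=> x /= hx; rewrite in_itv/=; apply: contraNT hx => xac.
rewrite hump_eq0//; apply: contra xac => /andP[ax xc].
by rewrite !ltW.
Qed.

Lemma compact_tsupport_hump k (a c : R) : compact (tsupport (hump k a c)).
Proof.
apply: (subclosed_compact _ _ (@tsupport_hump k a c)); first exact: closed_closure.
exact: segment_compact.
Qed.

Context (J K : R -> R) (w : R * R -> R).
Context (J_C2 : Ck 2 J) (KJ : forall x : R, is_derive x 1 K (J x)) (bw : bmeas2 w).

Let cJ : continuous J. Proof. exact: Ck_continuous J_C2. Qed.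
Let cK : continuous K. Proof. exact: is_derive_continuous KJ. Qed.

Lemma qflux_shift (v r : R) : qflux J K (v, r) =
  qflux J K (v, 0) + ((-2 * r) * J v + (2 * K r - 2 * K 0)).
Proof. by rewrite /qflux /=; ring. Qed.

Lemma continuous_qflux (r : R) : continuous (fun v => qflux J K (v, r)).
Proof. by apply: is_derive_continuous => v; exact: is_derive_qflux. Qed.

(** With the second argument varying in t, the flux is split by [qflux_shift] into products and sums
    of functions of [w] alone and of [rho] alone. *)
Lemma bmeas2_qflux (rho : R -> R) : bmeas rho -> bmeas2 (fun p => qflux J K (w p, rho p.1)).
Proof.
move=> brho; have c2 (c : R) : bmeas2 (fun=> c) by exact: (bmeas2_fst (bmeas_cst c)).
have br := bmeas2_fst brho.
have bKr : bmeas2 (fun p => K (rho p.1)) := bmeas2_comp br cK.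
have H := bmeas2D (bmeas2_comp bw (@continuous_qflux 0))
  (bmeas2D (bmeas2M (bmeas2M (c2 (-2)) br) (bmeas2_comp bw cJ))
           (bmeas2D (bmeas2M (c2 2) bKr) (c2 (- (2 * K 0))))).
rewrite (_ : (fun p => _) = (fun p => qflux J K (w p, 0) +
  (-2 * rho p.1 * J (w p) + (2 * K (rho p.1) + - (2 * K 0)))))//.
by apply/funext => p; rewrite qflux_shift.
Qed.

Lemma ordered_averages_qflux (rho : R -> R) :
  (forall c, ordered_averages (fun p => c * J (w p))) ->
  ordered_averages (fun p => qflux J K (w p, 0)) -> bmeas rho ->
  ordered_averages (fun p => qflux J K (w p, rho p.1)).
Proof.
move=> oJ oQ brho; apply: ae_imp (ae_and (ae_and (oJ 1) (oJ (-1))) oQ).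
move=> t [[J1 J2] Q0] t0 p q r s p0 pq qr rs s1.
have {J1} := J1 t0 p q r s p0 pq qr rs s1.
have {J2} := J2 t0 p q r s p0 pq qr rs s1.
have {Q0} := Q0 t0 p q r s p0 pq qr rs s1.
have bJ : bmeas (fun x => J (w (t, x))) := bmeas2_slice1 t (bmeas2_comp bw cJ).
have bQ : bmeas (fun x => qflux J K (w (t, x), 0)) :=
  bmeas2_slice1 t (bmeas2_comp bw (@continuous_qflux 0)).
rewrite /= !(avgZ _ _ _ bJ) => Q0 J2 J1.
have E a b : a < b -> avg (fun x => qflux J K (w (t, x), rho t)) a b =
    avg (fun x => qflux J K (w (t, x), 0)) a b +
    ((-2 * rho t) * avg (fun x => J (w (t, x))) a b + (2 * K (rho t) - 2 * K 0)).
  move=> ab; rewrite -(avg_cst (2 * K (rho t) - 2 * K 0) ab).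
  have bZ : bmeas (fun x => (-2 * rho t) * J (w (t, x))).
    by apply: bmeasM => //; exact: bmeas_cst.
  have bC : bmeas (fun=> 2 * K (rho t) - 2 * K 0) by exact: bmeas_cst.
  rewrite -(avgZ _ _ _ bJ) -(avgD _ _ bZ bC) -(avgD _ _ bQ (bmeasD bZ bC)).
  by congr avg; apply/funext => x; exact: qflux_shift.
rewrite !E//.
(* The orderings for J and for -J together give equality, so the term in [rho t] shifts both
   averages by the same amount, whatever its sign. *)
have -> : avg (fun x => J (w (t, x))) (ratr r) (ratr s) =
    avg (fun x => J (w (t, x))) (ratr p) (ratr q) by lra.
by rewrite lerD2r.
Qed.

End assembly.

(** * Entropy solutions *)

Section entropy_solutions.
Context {R : realType} (J K : R -> R) (m : R) (rhom rhop : R -> R) (u w : R * R -> R).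
Context (J_C2 : Ck 2 J) (J_concave : forall v, J^`(2)%classic v < 0)
  (J0 : J 0 = 0) (J1 : J 1 = 0) (m01 : 0 < m < 1)
  (m_unique_max : forall v, v != m -> J v < J m)
  (rhom_C1 : C1_Rplus rhom) (rhop_C1 : C1_Rplus rhop)
  (rhom01 : forall t, 0 <= t -> 0 <= rhom t <= 1)
  (rhop01 : forall t, 0 <= t -> 0 <= rhop t <= 1)
  (u_sol : entropy_solution J rhom rhop u)
  (KJ : forall x : R, is_derive x 1 K (J x))
  (mv : measurable_fun setT (u \_ (@space_time R))) (bw : bmeas2 w)
  (uw : {ae leb2 R, forall p, space_time p -> u p = w p}).
Notation mu := (leb R).

Let cJ : continuous J. Proof. exact: Ck_continuous J_C2. Qed.
Let cK : continuous K. Proof. exact: is_derive_continuous KJ. Qed.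

Lemma ordered_lax (S Q : R -> R) : lax_pair J S Q -> ordered_averages (fun p => Q (w p)).
Proof.
move=> SQ; have [_ _ ent _] := u_sol.
apply: (averages_nonincreasing mv bw uw) => [|phi tphi phi0].
  by have [_ CQ _ _] := SQ; exact: Ck_continuous CQ.
exact: ent SQ tphi phi0.
Qed.

Let oJ c : ordered_averages (fun p => c * J (w p)).
Proof. exact: ordered_lax (lax_affine c J_C2). Qed.

Let oQ : ordered_averages (fun p => qflux J K (w p, 0)).
Proof. exact: ordered_lax (lax_quadratic 0 J_C2 KJ). Qed.

Lemma slice_monotone : {ae mu, forall t, 0 <= t -> exists2 G : R -> Prop,
  {ae mu, forall x, G x} & forall x y, G x -> G y -> 0 < x -> x < y -> y < 1 ->
    J (w (t, x)) = J (w (t, y)) /\ qflux J K (w (t, y), 0) <= qflux J K (w (t, x), 0)}.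
Proof.
apply: ae_imp (ae_and (ae_and (oJ 1) (oJ (-1))) oQ) => t [[oJ1 oJ2] oQt] t0.
have bJ c : bmeas (fun x => c * J (w (t, x))).
  by apply: bmeasM; [exact: bmeas_cst|exact: bmeas2_slice1 t (bmeas2_comp bw cJ)].
have bQ : bmeas (fun x => qflux J K (w (t, x), 0)).
  exact: bmeas2_slice1 t (bmeas2_comp bw (continuous_qflux J_C2 KJ (r := 0))).
have [G1 aG1 G1P] := nonincreasing_from_rational (bJ 1) (oJ1 t0).
have [G2 aG2 G2P] := nonincreasing_from_rational (bJ (-1)) (oJ2 t0).
have [G3 aG3 G3P] := nonincreasing_from_rational bQ (oQt t0).
exists (fun x => (G1 x /\ G2 x) /\ G3 x).
  exact: ae_and (ae_and aG1 aG2) aG3.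
move=> x y [[x1 x2] x3] [[y1 y2] y3] x0 xy yy1; split; last exact: G3P.
have := G1P x y x1 y1 x0 xy yy1; have := G2P x y x2 y2 x0 xy yy1; lra.
Qed.

Lemma boundary_bounds :
  {ae mu, forall t, 0 <= t -> {ae mu, forall x, 0 < x < 1 -> 0 <= w (t, x) <= 1}}.
Proof.
have [_ _ _ bdy] := u_sol; have QB := boundary_quadratic J_C2 KJ.
have bhm := bmeas_C1_Rplus rhom_C1 rhom01.
have bhp := bmeas_C1_Rplus rhop_C1 rhop01.
have cH k (a c : R) : continuous (hump k a c) by exact: Ck_continuous (Ck_hump 0 k a c).
have left : {ae mu, forall t, 0 <= t -> {ae mu, forall x, 0 < x < 1 ->
    qflux J K (w (t, x), (rhom \_ `[0, +oo[) t) <= 0}}.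
  apply: (@trace_left _ (fun p => qflux J K (w p, (rhom \_ `[0, +oo[) p.1))).
  - exact: bmeas2_qflux.
  - exact: ordered_averages_qflux.
  move=> k a c e a0 ac e0.
  have [[l l0 Fl] _] := bdy _ _ QB (cH k a c) (@compact_tsupport_hump _ k a c)
    (hump_ge0 k a c).
  have [d d0 Hd] := ess_lim0_near Fl e0.
  (* The cap at 1 keeps x inside the strip, where [boundary_integral] holds. *)
  exists (Num.min d 1); first by rewrite lt_min d0 ltr01.
  apply: ae_imp (ae_and Hd (boundary_integral k a c mv bw uw cJ cK bhm)) => x [xl xE].
  rewrite lt_min => /and3P[x0 xd x1].
  rewrite -xE ?x0//; move: (xl); rewrite x0 xd => /(_ isT).
  by rewrite ler_norml; lra.
have right : {ae mu, forall t, 0 <= t -> {ae mu, forall x, 0 < x < 1 ->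
    0 <= qflux J K (w (t, x), (rhop \_ `[0, +oo[) t)}}.
  apply: (@trace_right _ (fun p => qflux J K (w p, (rhop \_ `[0, +oo[) p.1))).
  - exact: bmeas2_qflux.
  - exact: ordered_averages_qflux.
  move=> k a c e a0 ac e0.
  have [_ [l l0 Fl]] := bdy _ _ QB (cH k a c) (@compact_tsupport_hump _ k a c)
    (hump_ge0 k a c).
  have [d d0 Hd] := ess_lim0_near Fl e0.
  exists (Num.min d 1); first by rewrite lt_min d0 ltr01.
  apply: ae_imp (ae_and (ae_onem Hd) (boundary_integral k a c mv bw uw cJ cK bhp)) => x [xl xE].
  rewrite ltrBlDr -ltrBlDl lt_min => /andP[/andP[xd x0] x1].
  rewrite -xE ?x1 ?andbT; last by lra.
  move: (xl); rewrite xd subr_gt0 x1 => /(_ isT); rewrite subKr.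
  by rewrite ler_norml; lra.
apply: ae_imp (ae_and left right) => t [Lt Rt] t0.
apply: ae_imp (ae_and (Lt t0) (Rt t0)) => x [Lx Rx] x01.
have tE f : (f \_ `[0, +oo[) t = f t by rewrite patchE mem_set//= in_itv/= t0.
apply/andP; split.
  apply: (qflux_le0 J_C2 J_concave m_unique_max KJ J0 J1 m01 (rhom01 t0)).
  by rewrite -tE; exact: Lx.
apply: (qflux_ge0 J_C2 J_concave m_unique_max KJ J0 J1 m01 (rhop01 t0)).
by rewrite -tE; exact: Rx.
Qed.

(** The constant value of J on the slice at almost every t >= 0, written as an integral so that it
    is measurable in t. *)
Definition flux_level (t : R) := \int[mu]_(x in `]0, 1[) J (w (t, x)).

Lemma slice_level : {ae mu, forall t, 0 <= t -> {ae mu, forall x, 0 < x < 1 ->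
  J (w (t, x)) = flux_level t}}.
Proof.
apply: ae_imp slice_monotone => t + t0 => /(_ t0)[G aG GP].
have [x0 /andP[x00 x01] Gx0] := ae_ex aG.
have H : {ae mu, forall x, 0 < x < 1 -> J (w (t, x)) = J (w (t, x0))}.
  apply: ae_imp aG => x Gx /andP[x_0 x_1]; have [xx|xx|->//] := ltgtP x x0.
    by have [] := GP x x0 Gx Gx0 x_0 xx x01.
  by have [] := GP x0 x Gx0 Gx x00 xx x_1.
suff E : flux_level t = J (w (t, x0)) by apply: ae_imp H => x Hx /Hx ->.
have bJ : bmeas (fun x => J (w (t, x))) := bmeas2_slice1 t (bmeas2_comp bw cJ).
rewrite -[RHS]mulr1 -[X in _ * X](subr0 1) -(Rintegral_itv_cst _ ltr01).
by apply: ae_Rintegral_eq => //; exact: measurable_funS bJ.1.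
Qed.

(** The bounds and the level are known slice by slice. Tonelli turns null slices into a null planar
    set only if that set is measurable, which is why the condition is encoded by the boolean
    [good]. *)
Lemma flux_level_ae : {ae leb2 R, forall p, space_time p ->
  0 <= w p <= 1 /\ J (w p) = flux_level p.1}.
Proof.
pose good (p : R * R) : bool := [&& 0 <= w p, w p <= 1 & J (w p) == flux_level p.1].
have mw := bw.1.
have mgood : measurable_fun setT good.
  apply: measurable_and; first exact: measurable_fun_ler.
  apply: measurable_and; first exact: measurable_fun_ler.
  apply: measurable_fun_eqr; first exact: (bmeas2_comp bw cJ).1.
  have bl : bmeas flux_level.
    exact: (bmeas_Rintegral_snd false true 0 1 (bmeas2_comp bw cJ)).
  exact: (bmeas2_fst bl).1.
pose N := @space_time R `&` (good @^-1` [set false]).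
have mN : measurable (N : set (measurableTypeR R * measurableTypeR R)).
  apply: measurableI; first exact: space_time_measurable.
  by rewrite -[X in measurable X]setTI; exact: mgood.
exists N; split => //.
  apply: (null_from_sections mN).
  apply: ae_imp (ae_and boundary_bounds slice_level) => t [Bt Lt].
  have [t0|t0] := ltP t 0.
    apply: aeW => x -[[/= + _] _]; rewrite in_itv/= andbT => t0'.
    by move: t0; rewrite ltNge t0'.
  apply: ae_imp (ae_and (ae_and (Bt t0) (Lt t0)) (ae_and (ae_neq 0) (ae_neq 1))).
  move=> x [[Bx Lx] [x0 x1]] [[/= _ +] /negP]; rewrite in_itv/= => /andP[x0' x1'].
  have x01 : 0 < x < 1 by rewrite !lt_neqAle x0' x1' !andbT eq_sym; apply/andP; split; apply/eqP.
  by apply; have /andP[? ?] := Bx x01; apply/and3P; split => //; apply/eqP/Lx.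
move=> p /= /not_implyP[Dp H]; split => //; apply/negP => /and3P[w0 w1 /eqP wJ].
by apply: H; rewrite w0 w1.
Qed.

End entropy_solutions.

Theorem proposition3p1 (R : realType) (J : R -> R) (m : R)
  (rhom rhop : R -> R) (u : R * R -> R)
  (J_C2 : Ck 2 J) (J_concave : forall v, J^`(2)%classic v < 0)
  (J0 : J 0 = 0) (J1 : J 1 = 0)
  (m01 : 0 < m < 1) (m_unique_max : forall v, v != m -> J v < J m)
  (rhom_C1 : C1_Rplus rhom) (rhop_C1 : C1_Rplus rhop)
  (rhom01 : forall t, 0 <= t -> 0 <= rhom t <= 1)
  (rhop01 : forall t, 0 <= t -> 0 <= rhop t <= 1)
  (u_sol : entropy_solution J rhom rhop u) :
  exists z1 z2 : R -> R,
  [/\ (forall t, 0 <= t ->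
         [/\ 0 <= z1 t <= m, m <= z2 t <= 1 & J (z1 t) = J (z2 t)]),
      {ae leb2 R, forall p, @space_time R p -> u p = z1 p.1 \/ u p = z2 p.1},
      {ae leb R, forall t, 0 <= t ->
         (exists c, {ae leb R, forall x, 0 < x < 1 -> u (t, x) = c}) \/
         (exists2 X, 0 < X < 1 &
            {ae leb R, forall x, 0 < x < 1 ->
               (x < X -> u (t, x) = z1 t) /\ (X < x -> u (t, x) = z2 t)})}
    & {ae leb R, forall t, 0 <= t ->
         exists2 v : R -> R, bounded_variation 0 1 v &
           {ae leb R, forall x, 0 < x < 1 -> u (t, x) = v x}}].
Proof.
have cJ : continuous J := Ck_continuous J_C2.
have [K KJ] := antiderivative cJ.
have [uL _ _ _] := u_sol; have [mv [w bw uw]] := truncation uL.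
pose j := flux_level J w.
(* Both branches are chosen as functions of the level alone. Levels outside the range [[0, J m]]
   receive the default [(m, m)], so that the constraints on z1 and z2 hold at every t and not just
   almost everywhere. *)
have /choice[z zP] : forall c, exists z : R * R,
    [/\ 0 <= z.1 <= m, m <= z.2 <= 1, J z.1 = J z.2 & 0 <= c <= J m -> J z.1 = c].
  move=> c; have [cJm|] := boolP (0 <= c <= J m).
    have [z [z1 z2 zc1 zc2]] := level_branches J_C2 J0 J1 m01 cJm.
    by exists z; split => //; rewrite zc1 zc2.
  move=> _; have /andP[m0 m1] := m01.
  by exists (m, m); split => //=; rewrite ?lexx ?(ltW m0) ?(ltW m1).
have uz : {ae leb2 R, forall p, space_time p -> u p = (z (j p.1)).1 \/ u p = (z (j p.1)).2}.
  have lev := flux_level_ae J_C2 J_concave J0 J1 m01 m_unique_max rhom_C1 rhop_C1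
    rhom01 rhop01 u_sol KJ mv bw uw.
  apply: ae_imp (ae_and lev uw) => p [+ +] Dp => /(_ Dp)[/andP[w0 w1] wJ] /(_ Dp) ->.
  have [/andP[_ z1m] /andP[mz2 _] zz zJ] := zP (j p.1).
  have Jw0 : 0 <= J (w p).
    exact: (concave_ge0 J_C2 J_concave m_unique_max J0 J1 w0 w1).
  have jJ : 0 <= j p.1 <= J m by rewrite /j -wJ Jw0 (concave_le_max m_unique_max).
  have Jz : J (w p) = J (z (j p.1)).1 by rewrite (zJ jJ).
  by apply: (level_set J_C2 J_concave m_unique_max z1m mz2 Jz); rewrite Jz zz.
have shape : {ae leb R, forall t, 0 <= t ->
   (exists c, {ae leb R, forall x, 0 < x < 1 -> u (t, x) = c}) \/
   (exists2 X, 0 < X < 1 & {ae leb R, forall x, 0 < x < 1 ->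
      (x < X -> u (t, x) = (z (j t)).1) /\ (X < x -> u (t, x) = (z (j t)).2)})}.
  have mono := slice_monotone J_C2 u_sol KJ mv bw uw.
  apply: ae_imp (ae_and (ae_and (ae_prod1 uz) (ae_prod1 uw)) mono).
  move=> t [[uzt uwt] /[swap] t0 /(_ t0)[G aG GP]].
  have st x : 0 < x < 1 -> space_time (t, x).
    by move=> /andP[x0 x1]; split; rewrite /= in_itv/= ?t0// !ltW.
  apply: (two_valued_step (ae_and (ae_and uzt uwt) aG)).
    by move=> x [[ux _] _] /st; exact: ux.
  move=> x y [[ux uwx] Gx] [[uy uwy] Gy] x0 xy y1 uxE.
  have sx : space_time (t, x) by apply: st; rewrite x0 (lt_trans xy).
  have sy : space_time (t, y) by apply: st; rewrite y1 (lt_trans x0).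
  (* Suppose the value returns to z1 at y after z2 at x. Either z1 = z2, or [qflux] strictly
     increases from x to y, against its monotonicity. *)
  have [uyE|//] := uy sy.
  have [/andP[_ z1m] /andP[mz2 _] zz _] := zP (j t).
  have := le_trans z1m mz2; rewrite le_eqVlt => /predU1P[<-//|zlt].
  have [_] := GP x y Gx Gy x0 xy y1.
  rewrite -(uwx sx) -(uwy sy) uxE uyE => /=; rewrite leNgt.
  by rewrite (qflux_drop J_C2 J_concave m_unique_max KJ).
exists (fun t => (z (j t)).1), (fun t => (z (j t)).2); split => //.
  by move=> t _; have [z1 z2 zz _] := zP (j t).
apply: ae_imp shape => t + t0 => /(_ t0)[[c uc]|[X _ uX]].
  exists (fun=> c) => //; exact: nondecreasing_bounded_variation.
exists (fun x => if x < X then (z (j t)).1 else (z (j t)).2).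
  apply: step_bounded_variation; have [/andP[_ z1m] /andP[mz2 _] _ _] := zP (j t).
  exact: le_trans mz2.
apply: ae_imp (ae_and uX (ae_neq X)) => x [+ xX] x01 => /(_ x01)[u1 u2].
by case: ltP => [/u1//|]; rewrite le_eqVlt => /predU1P[/esym//|/u2].
Qed.
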